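(* Let $(f,g),(F,G)\in\mathscr{C}_6(I)$ and let $\mu:=\frac{\delta_0+\delta_1}{2}$. Then the following assertions are equivalent: (i) The means $M_{f,g;\mu}$ and $M_{F,G;\mu}$ are equal on $I^2$. (ii) The means $M_{f,g;\mu}$ and $M_{F,G;\mu}$ are equal near the diagonal of $I^2$. (iii) For all $x\in I$, the equalities $m_{x;f,g;\mu}''(0)=m_{x;F,G;\mu}''(0)$, $m_{x;f,g;\mu}''''(0)=m_{x;F,G;\mu}''''(0)$ and $m_{x;f,g;\mu}''''''(0)=m_{x;F,G;\mu}''''''(0)$ (derivatives of order 2, 4 and 6) are satisfied. (iv) $\Phi_{f,g}=\Phi_{F,G}$ holds on $I$ and there exist real constants $\alpha$ and $\beta$ such that $$\Psi_{f,g}=\alpha\big(W_{f,g}^{1,0}\big)^2\qquad\text{and}\qquad \Psi_{F,G}=\beta\big(W_{f,g}^{1,0}\big)^2$$ hold on $I$. (v) Either $(f,g)\sim(F,G)$ or there exist real constants $a,b,c,A,B,C,\gamma$ such that $$af^2+bfg+cg^2=1\qquad\text{and}\qquad AF^2+BFG+CG^2=1$$ and $W_{F,G}^{1,0}=\gamma W_{f,g}^{1,0}$. (vi) Either $(f,g)\sim(F,G)$ or there exist two real polynomials $P$ and $Q$ of at most second degree which are positive on the range of $f/g$ and $F/G$, respectively, and there exist real constants $\gamma$ and $\delta$ such that $$g=\frac{1}{\sqrt{P}}\circ\frac{f}{g},\qquad G=\frac{1}{\sqrt{Q}}\circ\frac{F}{G},\qquad\text{and}\qquad \bigg(\int\frac{1}{Q}\bigg)\circ\frac{F}{G}=\gamma\bigg(\int\frac{1}{P}\bigg)\circ\frac{f}{g}+\delta.$$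 (vii) Either $(f,g)\sim(F,G)$ or there exist a strictly monotone function $\varphi:I\to\mathbb{R}$ and real constants $\alpha$ and $\beta$ such that $$(f,g)\sim(S_\alpha\circ\varphi,\,C_\alpha\circ\varphi)\qquad\text{and}\qquad (F,G)\sim(S_\beta\circ\varphi,\,C_\beta\circ\varphi).$$ (viii) Either $(f,g)\sim(F,G)$ or $M_{f,g;\mu}=A_\varphi=M_{F,G;\mu}$ holds on $I^2$ with $\varphi:=\int W_{f,g}^{1,0}$. (ix) Either $(f,g)\sim(F,G)$ or there exists a strictly monotone function $\varphi:I\to\mathbb{R}$ such that $M_{f,g;\mu}=A_\varphi=M_{F,G;\mu}$ holds on $I^2$.
   Context: Throughout, $I$ is a nonempty open real interval and $\delta_\tau$ is the Dirac measure concentrated at $\tau\in[0,1]$. For $n\in\mathbb{N}$, $\mathscr{C}_n(I)$ is the class of all pairs $(f,g)$ of $n$-times continuously differentiable functions $f,g:I\to\mathbb{R}$ such that $g$ is positive on $I$ and $f'g-fg'$ does not vanish anywhere on $I$ (so $f/g$ is continuous and strictly monotone). For a pair $(f,g)$ of continuous functions with $g>0$ and $f/g$ strictly monotone, and a Borel probability measure $\mu$ on $[0,1]$, define $M_{f,g;\mu}:I^2\to I$ by $$M_{f,g;\mu}(x,y):=\Big(\frac fg\Big)^{-1}\left(\frac{\int_0^1 f(tx+(1-t)y)\,d\mu(t)}{\int_0^1 g(tx+(1-t)y)\,d\mu(t)}\right).$$ Let $\widehat\mu_1:=\int_0^1 t\,d\mu(t)$. For fixed $x\in I$ and $u$ in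 a neighborhood of $0$, put $$m_{x;f,g;\mu}(u):=M_{f,g;\mu}\big(x+(1-\widehat\mu_1)u,\;x-\widehat\mu_1u\big).$$ Two such means are equal near the diagonal $\Delta(I):=\{(x,x)\mid x\in I\}$ of $I^2$ if there exists an open set $U\subseteq I^2$ containing a dense subset $D$ of $\Delta(I)$ such that the two means are equal at every point of $U$. Wronskian-type determinants: $W_{f,g}^{i,j}:=f^{(i)}g^{(j)}-f^{(j)}g^{(i)}$; and $$\Phi_{f,g}:=\frac{W_{f,g}^{2,0}}{W_{f,g}^{1,0}},\qquad \Psi_{f,g}:=-\frac{W_{f,g}^{2,1}}{W_{f,g}^{1,0}}.$$ For pairs of functions $I\to\mathbb{R}$, $(f,g)\sim(F,G)$ means that there exist real constants $a,b,c,d$ with $ad\neq bc$ such that $F=af+bg$ and $G=cf+dg$. For a continuous strictly monotone $\varphi:I\to\mathbb{R}$, $A_\varphi(x,y):=\varphi^{-1}\big(\frac{\varphi(x)+\varphi(y)}2\big)$ is the quasiarithmetic mean generated by $\varphi$. For $t\in\mathbb{R}$, $S_t,C_t:\mathbb{R}\to\mathbb{R}$ are: $S_t(x)=\sin(\sqrt{-t}\,x)$, $C_t(x)=\cos(\sqrt{-t}\,x)$ if $t<0$; $S_0(x)=x$, $C_0(x)=1$; $S_t(x)=\sinh(\sqrt t\,x)$, $C_t(x)=\cosh(\sqrt t\,x)$ if $t>0$. The symbol $\int h$ denotes an antiderivative of $h$ (on $I$, or on the interval $(f/g)(I)$, resp. $(F/G)(I)$, for $1/P$, resp. $1/Q$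).
   Formalization: Assertion (iv) is read as ''Either (f,g)∼(F,G) or [the printed condition]'', since as printed it fails for f=F=x², g=G=x on (1,2), where (i) holds but Ψ=-2/x² is not a constant multiple of (W^{1,0})²=x⁴. *)

(* Defs.v *)
From HB Require Import structures.
From mathcomp Require Import all_boot all_order all_algebra.
From mathcomp Require Import unstable all_classical all_reals all_analysis.

Set Implicit Arguments.
Unset Strict Implicit.
Unset Printing Implicit Defensive.

Import Order.TTheory GRing.Theory Num.Theory.
Import numFieldNormedType.Exports.

Local Open Scope ring_scope.
Local Open Scope classical_set_scope.

(* Functions on the interval I are represented by total functions R -> R whose
   values outside of I are irrelevant. All the derivatives below are two-sided,
   and are only taken at points of an open set. *)

Section function_classes.
Context {R : realType}.
Implicit Types (I : set R) (f g p h : R -> R).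

Definition continuously_differentiable (n : nat) I f : Prop :=
  (forall k x, (k < n)%N -> I x -> derivable (derive1n k f) x 1) /\
  (forall k, (k <= n)%N -> {in I, continuous (derive1n k f)}).

Definition wronskian (i j : nat) f g : R -> R :=
  fun x => derive1n i f x * derive1n j g x - derive1n j f x * derive1n i g x.

Definition Phi f g : R -> R :=
  fun x => wronskian 2 0 f g x / wronskian 1 0 f g x.

Definition Psi f g : R -> R :=
  fun x => - (wronskian 2 1 f g x / wronskian 1 0 f g x).

Definition class_C (n : nat) I f g : Prop :=
  [/\ continuously_differentiable n I f,
      continuously_differentiable n I g,
      forall x, I x -> 0 < g x
    & forall x, I x -> wronskian 1 0 f g x != 0].

Definition equivalent_pairs I f g F G : Prop :=
  exists a b c d : R, a * d != b * c /\
    forall x, I x -> F x = a * f x + b * g x /\ G x = c * f x + d * g x.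

Definition antiderivative (J : set R) h p : Prop :=
  forall y, J y -> is_derive y 1 p (h y).

Definition sinh (x : R) : R := (expR x - expR (- x)) / 2.

Definition cosh (x : R) : R := (expR x + expR (- x)) / 2.

Definition S_ (t x : R) : R :=
  if t < 0 then sin (Num.sqrt (- t) * x)
  else if t == 0 then x
  else sinh (Num.sqrt t * x).

Definition C_ (t x : R) : R :=
  if t < 0 then cos (Num.sqrt (- t) * x)
  else if t == 0 then 1
  else cosh (Num.sqrt t * x).

End function_classes.

Section half_dirac.
Context {R : realType}.

Definition half_dirac : set (measurableTypeR R) -> \bar R :=
  mscale (2^-1)%:nng
    (measure_add (\d_(0 : measurableTypeR R)) (\d_(1 : measurableTypeR R))).

HB.instance Definition _ := Measure.on half_dirac.

Let half_dirac_setT : half_dirac [set: _] = 1%E.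
Proof.
rewrite /half_dirac /mscale/= /msum !big_ord_recl big_ord0/= !diracT adde0.
rewrite -EFinD -EFinM.
by rewrite -[1 + 1]/(2%:R) mulVf// pnatr_eq0.
Qed.

HB.instance Definition _ :=
  Measure_isProbability.Build _ _ _ half_dirac half_dirac_setT.

End half_dirac.

Section means.
Context {R : realType}.
Implicit Types (I : set R) (f g phi : R -> R) (M N : R -> R -> R).
Implicit Types (mu : probability (measurableTypeR R) R).

(* [pinv I h] inverts the restriction of h to I: for h injective on I and v in
   h @` I, [pinv I h v] is the point of I at which h takes the value v.
   Borel probability measures on [0, 1] are represented by probabilities on R,
   which are only integrated over [0, 1]. *)
Definition mean I f g mu (x y : R) : R :=
  pinv I (fun s => f s / g s)
    ((\int[mu]_(t in `[0, 1]) f (t * x + (1 - t) * y)) /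
     (\int[mu]_(t in `[0, 1]) g (t * x + (1 - t) * y))).

Definition first_moment mu : R := \int[mu]_(t in `[0, 1]) t.

(* For x in I, [mean_section I f g mu x u] is meaningful for u close to 0. *)
Definition mean_section I f g mu (x u : R) : R :=
  mean I f g mu (x + (1 - first_moment mu) * u) (x - first_moment mu * u).

Definition quasiarithmetic_mean I phi (x y : R) : R :=
  pinv I phi ((phi x + phi y) / 2).

Definition equal_on_square I M N : Prop :=
  forall x y, I x -> I y -> M x y = N x y.

Definition diagonal I : set (R * R) := [set p | I p.1 /\ p.1 = p.2].

Definition equal_near_diagonal I M N : Prop :=
  exists U D : set (R * R),
    [/\ open U, U `<=` I `*` I, D `<=` diagonal I /\ diagonal I `<=` closure D,
        D `<=` U
      & forall p, U p -> M p.1 p.2 = N p.1 p.2].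

End means.

(* Main.v *)
(* Write w = W^{1,0}_{f,g}. Both f and g solve y'' = Phi y' + Psi y, with Phi = w' / w,
   and in the variable phi with phi' = w this equation reads y'' = (Psi / w^2) y.
   Differentiating f(m)(g(x + u/2) + g(x - u/2)) = g(m)(f(x + u/2) + f(x - u/2)) at
   u = 0 up to order 6 expresses the derivatives of the mean m by those of Phi and
   Psi. Orders 2, 4 and 6 give, with D = Psi_{f,g} - Psi_{F,G},
     Phi_{f,g} = Phi_{F,G},  D' = 2 Phi D,  D (Psi_{f,g}' - 2 Phi Psi_{f,g}) = 0.
   By the second equation D is a constant multiple of w^2. If D = 0, both pairs
   solve the same linear equation; otherwise Psi_{f,g} / w^2 is constant, hence also
   Psi_{F,G} / w^2. By continuity, it suffices to have the equalities of derivatives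
   on a dense subset of I, so (ii) implies (iv) directly, and (iii) follows from (ii)
   by way of (i).
   If Psi / w^2 is a constant alpha, the equation y'' = alpha y has quadratic first
   integrals, which yield the relation (v); conversely (v) amounts to a first-order
   linear system with constant coefficients in the variable phi, whence S_alpha o phi
   and C_alpha o phi, and the addition formulas identify the mean with A_phi. *)
Require Import Defs.
From HB Require Import structures.
From mathcomp Require Import all_boot all_order all_algebra.
From mathcomp Require Import unstable all_classical all_reals all_analysis.
From mathcomp Require Import measurable_realfun ring lra.

Set Implicit Arguments.
Unset Strict Implicit.
Unset Printing Implicit Defensive.

Import Order.TTheory GRing.Theory Num.Theory.
Import numFieldNormedType.Exports.

Local Open Scope ring_scope.
Local Open Scope classical_set_scope.

(** * Derivatives on an open interval *)

(** The mean enters the computations only through f(m)(g x + g y) = g(m)(f x + f y), which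
    determines m in I and involves no inverse function; f / g is inverted only to prove smoothness.
    Order 6 is the first at which Psi enters nonlinearly. When Phi = 0, the derivatives of orders 4
    and 6 are Psi' / 8 and Psi''' / 16 - 3 Psi Psi' / 8. Equality at order 4 then leaves a constant
    free in Psi, and a nonzero constant is compatible with order 6 only if Psi' = 0. No existence
    theorem for differential equations is invoked: solutions are compared through Wronskians, which
    are constant multiples of w, and Cramer's rule supplies the coefficients. The obstacle is (vii),
    where phi is strictly monotone but perhaps discontinuous, since the trigonometric functions do
    not see a jump by a common period. The proportionality of the two Wronskians therefore cannot be
    read off from phi'; right limits and slope functions at 0 replace differentiation of phi. *)

Section calculus.
Context {R : realType}.
Implicit Types (I : set R) (f g h m : R -> R).

Lemma is_deriveD_fun f g (x a b : R) :
  is_derive x 1 f a -> is_derive x 1 g b ->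
  is_derive x 1 (fun y => f y + g y) (a + b).
Proof. by move=> ? ?; exact: is_deriveD. Qed.

Lemma is_deriveB_fun f g (x a b : R) :
  is_derive x 1 f a -> is_derive x 1 g b ->
  is_derive x 1 (fun y => f y - g y) (a - b).
Proof. by move=> ? ?; exact: is_deriveB. Qed.

Lemma is_deriveN_fun f (x a : R) :
  is_derive x 1 f a -> is_derive x 1 (fun y => - f y) (- a).
Proof. by move=> ?; exact: is_deriveN. Qed.

Lemma is_deriveM_fun f g (x a b : R) :
  is_derive x 1 f a -> is_derive x 1 g b ->
  is_derive x 1 (fun y => f y * g y) (a * g x + f x * b).
Proof.
move=> fa gb; apply: is_derive_eq (is_deriveM fa gb) _.
by rewrite /GRing.scale/=; ring.
Qed.

Lemma is_derive_cstM f (c x a : R) :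
  is_derive x 1 f a -> is_derive x 1 (fun y => c * f y) (c * a).
Proof.
move=> fa; apply: is_derive_eq (is_deriveM_fun (is_derive_cst c x 1) fa) _.
by rewrite mul0r add0r.
Qed.

Lemma is_deriveM_cst f (c x a : R) :
  is_derive x 1 f a -> is_derive x 1 (fun y => f y * c) (a * c).
Proof.
move=> /(is_derive_cstM c); rewrite mulrC => fa.
by have -> : (fun y => f y * c) = (fun y => c * f y) by apply/funext => y; exact: mulrC.
Qed.

Lemma is_deriveV_fun f (x a : R) : f x != 0 ->
  is_derive x 1 f a -> is_derive x 1 (fun y => (f y)^-1) (- a / f x ^+ 2).
Proof.
move=> fx fa; apply: is_derive_eq (is_deriveV fx fa) _.
by rewrite /GRing.scale/= mulNr mulrC mulNr mulrC.
Qed.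

Lemma is_derive_div f g (x a b : R) : g x != 0 ->
  is_derive x 1 f a -> is_derive x 1 g b ->
  is_derive x 1 (fun y => f y / g y) ((a * g x - f x * b) / g x ^+ 2).
Proof.
move=> gx fa gb; apply: is_derive_eq (is_deriveM_fun fa (is_deriveV_fun gx gb)) _.
by field.
Qed.

Lemma is_derive_comp_fun f g (x a b : R) :
  is_derive (g x) 1 f a -> is_derive x 1 g b ->
  is_derive x 1 (fun y => f (g y)) (a * b).
Proof. by move=> ? ?; exact: is_derive1_comp. Qed.

Lemma is_derive_affine (c d x : R) : is_derive x 1 (fun y => c * y + d) c.
Proof.
apply: is_derive_eq (is_deriveD_fun (is_derive_cstM c (is_derive_id x 1)) (is_derive_cst d x 1)) _.
by rewrite mulr1 addr0.
Qed.

Lemma is_derive_unique f (x a b : R) :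
  is_derive x 1 f a -> is_derive x 1 f b -> a = b.
Proof. by move=> [_ <-] [_ <-]. Qed.

Lemma derivable_is_derive f (x : R) : derivable f x 1 -> is_derive x 1 f (f^`() x).
Proof. by move=> fx; rewrite derive1E; exact: derivableP. Qed.

Lemma is_derive_derive1 f (x a : R) : is_derive x 1 f a -> f^`() x = a.
Proof. by move=> [_ <-]; rewrite derive1E. Qed.

Lemma is_derive_continuous f (x a : R) : is_derive x 1 f a -> {for x, continuous f}.
Proof.
by move=> [fx _]; apply: differentiable_continuous; apply/derivable1_diffP.
Qed.

Lemma open_near I (x : R) : open I -> I x -> \forall y \near x, I y.
Proof. by move=> Io Ix; exact: open_nbhs_nbhs. Qed.

Lemma eq_on_is_derive I f g (x a : R) : open I -> I x ->
  (forall y, I y -> f y = g y) -> is_derive x 1 f a -> is_derive x 1 g a.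
Proof.
move=> Io Ix fg; apply: near_eq_is_derive.
by near=> y; apply: fg; near: y; exact: open_near.
Unshelve. all: by end_near. Qed.

Lemma near_eq_derive1 f g (x : R) : (\forall y \near x, f y = g y) ->
  (\forall y \near x, f^`() y = g^`() y).
Proof.
move=> /near_join fg; near=> y.
rewrite !derive1E; apply: near_eq_derive; near: y; exact: fg.
Unshelve. all: by end_near. Qed.

Lemma near_eq_derive1n k f g (x : R) : (\forall y \near x, f y = g y) ->
  (\forall y \near x, derive1n k f y = derive1n k g y).
Proof.
elim: k f g => [//|k IH] f g fg; rewrite derive1nS.
by apply: near_eq_derive1; exact: IH.
Qed.

Lemma near_eq_derive1n_at k f g (x : R) : (\forall y \near x, f y = g y) ->
  derive1n k f x = derive1n k g x.
Proof. by move=> /(near_eq_derive1n k)/nbhs_singleton. Qed.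

Section on_interval.
Variable I : set R.
Hypothesis I_interval : is_interval I.

Lemma MVT_on f df (x y : R) :
  (forall t, I t -> is_derive t 1 f (df t)) -> I x -> I y -> x < y ->
  exists c, [/\ I c, x < c < y & f y - f x = df c * (y - x)].
Proof.
move=> fdf Ix Iy xy.
have Izz z : x <= z <= y -> I z by exact: I_interval.
have [z xzy|z|c cxy fE] := @MVT R f df x y xy.
- apply: fdf; apply: Izz.
  by move: xzy; rewrite in_itv/= => /andP[/ltW-> /ltW->].
- apply: continuous_in_subspaceT => t; rewrite inE/= => txy.
  by apply: is_derive_continuous; apply: fdf; by apply: Izz; rewrite in_itv/= in txy.
- exists c; move: cxy; rewrite in_itv/= => cxy; split => //.
  by apply: Izz; move: cxy => /andP[/ltW-> /ltW->].
Qed.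

Lemma derive0_cst f : (forall t, I t -> is_derive t 1 f 0) ->
  forall x y, I x -> I y -> f x = f y.
Proof.
move=> f0; suff H x y : I x -> I y -> x < y -> f x = f y.
  by move=> x y Ix Iy; case: (ltgtP x y) => [||->//] xy; [|symmetry]; exact: H.
move=> Ix Iy xy; have [c [_ _ /eqP]] := MVT_on f0 Ix Iy xy.
by rewrite mul0r subr_eq0 => /eqP.
Qed.

Lemma derive_neq0_inj f df : (forall t, I t -> is_derive t 1 f (df t)) ->
  (forall t, I t -> df t != 0) -> {in I &, injective f}.
Proof.
move=> fdf df0 x y; rewrite !inE => Ix Iy.
suff H a b : I a -> I b -> a < b -> f a <> f b.
  case: (ltgtP x y) => // [xy /(H _ _ Ix Iy xy)//|yx fxy].
  by case: (H _ _ Iy Ix yx).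
move=> Ia Ib ab fab; have [c [Ic _]] := MVT_on fdf Ia Ib ab.
rewrite fab subrr => /esym/eqP; rewrite mulf_eq0 (negbTE (df0 _ Ic))/= subr_eq0.
by rewrite gt_eqF.
Qed.

(** The sign of [df] need not be discussed: a continuous injective function on an interval is
    strictly monotone. *)
Lemma derive_neq0_monotonic f df : (forall t, I t -> is_derive t 1 f (df t)) ->
  (forall t, I t -> df t != 0) -> strict_monotonic I f.
Proof.
move=> fdf df0.
have IE : I = [set` Rhull I] by apply/is_intervalP.
have fc : {in I, continuous f}.
  by move=> t; rewrite inE => It; exact: is_derive_continuous (fdf _ It).
have finj := derive_neq0_inj fdf df0.
have : strict_monotonic (Rhull I) f.
  apply: itv_continuous_inj_mono.
    by rewrite -IE; exact: continuous_in_subspaceT.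
  by move=> x y xI yI; apply: finj; rewrite inE IE.
case=> [fm|fm].
  by left=> x y; rewrite !inE IE => Ix Iy; exact: fm.
by right=> x y; rewrite !inE IE => Ix Iy; exact: fm.
Qed.

Lemma IVT_on f (x y v : R) : {in I, continuous f} -> I x -> I y ->
  Num.min (f x) (f y) <= v <= Num.max (f x) (f y) -> exists2 c, I c & f c = v.
Proof.
wlog xy : x y / x <= y => [H fc Ix Iy v_|].
  case: (leP x y) => [xy|/ltW yx]; first exact: H v_.
  by apply: H yx _ _ _ _ => //; rewrite minC maxC.
move=> fc Ix Iy vP; have [|c cxy <-] := @IVT R f x y v xy _ vP.
  apply: continuous_in_subspaceT => t; rewrite inE/= in_itv/= => txy.
  by apply: fc; rewrite inE; exact: I_interval txy.
by exists c => //; move: cxy; rewrite in_itv/=; exact: I_interval.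
Qed.

Hypothesis I_open : open I.

Lemma is_derive_pinv f df : (forall t, I t -> is_derive t 1 f (df t)) ->
  (forall t, I t -> df t != 0) ->
  forall x, I x -> is_derive (f x) 1 (pinv I f) (df x)^-1.
Proof.
move=> fdf df0 x Ix; apply: is_derive_inverse; last 2 first.
- exact: fdf.
- exact: df0.
- near=> z; apply: pinvKV; first exact: derive_neq0_inj df0.
  by rewrite inE; near: z; exact: open_near.
- near=> z; apply: is_derive_continuous; apply: fdf.
  by near: z; exact: open_near.
Unshelve. all: by end_near. Qed.

End on_interval.

End calculus.

(** * Antiderivatives and integration against the half-Dirac measure *)

Section integration.
Context {R : realType}.
Implicit Types (I : set R) (f g w : R -> R).

Lemma open_ltr I (x : R) : open I -> I x -> exists2 c, I c & c < x.
Proof.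
move=> Io Ix; have /nbhs_ballP[e /= e0 H] := open_near Io Ix.
by exists (x - e / 2); [apply: H; rewrite /ball/= opprB addrC subrK gtr0_norm|]; lra.
Qed.

Lemma open_gtr I (x : R) : open I -> I x -> exists2 c, I c & x < c.
Proof.
move=> Io Ix; have /nbhs_ballP[e /= e0 H] := open_near Io Ix.
exists (x + e / 2); [apply: H|lra].
by rewrite /ball/= opprD addNKr normrN gtr0_norm; lra.
Qed.

(** The fundamental theorem differentiates the integral from [c] only to the right of [c], and an
    open interval has no least point to start from. The base point therefore moves with [x], below
    both [x] and a fixed [a], and subtracting the value at [a] makes the result independent of
    it. *)
Lemma antiderivative_exists I w : is_interval I -> open I ->
  {in I, continuous w} -> exists p, antiderivative I w p.
Proof.
move=> Ii Io wc.
pose W c x : R := \int[lebesgue_measure]_(t in `[c, x]) w t.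
have WE c x : I c -> I x -> c < x -> is_derive x 1 (W c) (w x).
  move=> Ic Ix cx; have [u Iu xu] := open_gtr Io Ix.
  have wint : lebesgue_measure.-integrable `[c, u] (EFin \o w).
    apply: continuous_compact_integrable; first exact: segment_compact.
    apply: continuous_in_subspaceT => t; rewrite inE/= in_itv/= => tcu.
    by apply: wc; rewrite inE; exact: Ii tcu.
  have [|dW <-] := continuous_FTC1_closed xu wint cx.
    by apply: wc; rewrite inE.
  exact: derivable_is_derive.
have [[a Ia]|I0] := pselect (I !=set0); last first.
  by exists id => y Iy; case: I0; exists y.
(* The integrals from [c] and from [d] have the same derivative to the right of both base points, so
   they differ there by a constant. *)
have W_indep c d x : I c -> I d -> I x -> c < x -> d < x -> c < a -> d < a ->
    W c x - W c a = W d x - W d a.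
  move=> Ic Id Ix cx dx ca da.
  pose J := I `&` [set t | c < t /\ d < t].
  have Ji : is_interval J.
    move=> s t [Is [cs ds]] [It _] z /andP[sz zt]; split.
      by apply: (Ii _ _ Is It); rewrite sz.
    by split; [exact: lt_le_trans sz|exact: lt_le_trans sz].
  suff : W c x - W d x = W c a - W d a by lra.
  apply: (derive0_cst Ji (f := fun t => W c t - W d t)) => // t [It [ct dt]].
  apply: is_derive_eq (is_deriveB_fun (WE _ _ Ic It ct) (WE _ _ Id It dt)) _.
  exact: subrr.
have below x : exists c, I x -> [/\ I c, c < x & c < a].
  have [Ix|] := pselect (I x); last by exists 0.
  have [xa|ax] := leP x a.
    have [c Ic cx] := open_ltr Io Ix; exists c => _; split => //.
    exact: lt_le_trans xa.
  have [c Ic ca] := open_ltr Io Ia; exists c => _; split => //.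
  exact: lt_trans ax.
pose c x := projT1 (cid (below x)).
have cP x : I x -> [/\ I (c x), c x < x & c x < a] by exact: projT2 (cid (below x)).
exists (fun x => W (c x) x - W (c x) a) => x Ix.
have [Icx cx ca] := cP _ Ix.
apply: (@near_eq_is_derive _ _ _ (fun y => W (c x) y - W (c x) a)).
  near=> y; have Iy : I y by near: y; exact: open_near.
  have [Icy cy cya] := cP _ Iy.
  apply: W_indep => //.
  by near: y; exact: lt_nbhsr.
apply: is_derive_eq (is_deriveB_fun (WE _ _ Icx Ix cx) (is_derive_cst _ _ _)) _.
exact: subr0.
Unshelve. all: by end_near. Qed.

(** The formulas for a scaled measure and for a sum of measures are applied to nonnegative
    integrands; hence the splitting into positive and negative parts, recombined by [maxB]. *)
Lemma Rintegral_half_dirac (h : R -> R) :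
  measurable_fun (`[0, 1] : set R) h ->
  \int[(half_dirac : probability (measurableTypeR R) R)]_(t in `[0, 1]) h t =
  (h 0 + h 1) / 2.
Proof.
move=> mh.
have mh' : measurable_fun (`[0, 1] : set (measurableTypeR R))
    (fun t : measurableTypeR R => (h t)%:E).
  exact/measurable_EFinP.
have ge0E (k : measurableTypeR R -> \bar R) :
    measurable_fun (`[0, 1] : set (measurableTypeR R)) k ->
    (forall t, 0 <= k t)%E ->
    (\int[half_dirac]_(t in `[0%R, 1%R]) k t = 2^-1%:E * (k 0%R + k 1%R))%E.
  move=> mk k0; rewrite ge0_integral_mscale//=; congr (_ * _)%E.
  rewrite ge0_integral_measure_add//= !integral_dirac//=.
  by rewrite !diracE !mem_set/= ?in_itv/= ?lexx ?ler01// !mul1e.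
rewrite /Rintegral integralE !ge0E//; last first.
- exact: (measurable_funepos mh').
- exact: (measurable_funeneg mh').
rewrite !funeposE !funenegE/= -!EFin_max -!EFinD/=.
have maxB (x : R) : Num.max x 0 - Num.max (- x) 0 = x.
  rewrite /Num.max; by case: ltP => ?; case: ltP => ?; lra.
by rewrite -{3}(maxB (h 0)) -{3}(maxB (h 1)); field.
Qed.

Lemma Rintegral_half_dirac_segment I f (x y : R) : is_interval I ->
  {in I, continuous f} -> I x -> I y ->
  \int[(half_dirac : probability (measurableTypeR R) R)]_(t in `[0, 1])
    f (t * x + (1 - t) * y) = (f x + f y) / 2.
Proof.
move=> Ii fc Ix Iy.
rewrite Rintegral_half_dirac; last first.
  apply: subspace_continuous_measurable_fun; first exact: measurable_itv.
  apply: continuous_in_subspaceT => t; rewrite inE/= in_itv/= => /andP[t0 t1].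
  apply: (@continuous_comp _ _ _ (fun t : R => t * x + (1 - t) * y) f).
    have -> : (fun t : R => t * x + (1 - t) * y) = (fun t => (x - y) * t + y).
      by apply/funext => s; ring.
    exact: is_derive_continuous (is_derive_affine _ _ _).
  apply: fc; rewrite inE; have [xy|/ltW yx] := leP x y.
    by apply: (Ii _ _ Ix Iy); apply/andP; split; nra.
  by apply: (Ii _ _ Iy Ix); apply/andP; split; nra.
by rewrite !mul0r !subr0 !mul1r subrr mul0r add0r addr0 addrC.
Qed.

Lemma first_moment_half_dirac :
  first_moment (half_dirac : probability (measurableTypeR R) R) = 2^-1.
Proof.
by rewrite /first_moment Rintegral_half_dirac// add0r mul1r.
Qed.

End integration.

(** * Smooth functions and their jets *)

Section smooth.
Context {R : realType}.
Implicit Types (I J : set R) (f g h m : R -> R).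
Local Notation smooth := continuously_differentiable.

Lemma smooth0 I f : {in I, continuous f} -> smooth 0 I f.
Proof. by move=> fc; split=> [//|k]; rewrite leqn0 => /eqP ->. Qed.

Lemma smooth_continuous n I f : smooth n I f -> {in I, continuous f}.
Proof. by case=> _ /(_ 0%N (leq0n _)). Qed.

Lemma smooth_derivative n I f : smooth n.+1 I f -> smooth n I f^`().
Proof.
move=> [fd fc]; split=> [k x kn Ix|k kn].
  by rewrite -derive1Sn; apply: fd.
by rewrite -derive1Sn; apply: fc.
Qed.

Lemma smooth_is_derive n I f x : smooth n.+1 I f -> I x -> is_derive x 1 f (f^`() x).
Proof. by move=> [fd _] Ix; exact: derivable_is_derive (fd 0%N x _ Ix). Qed.

Lemma smooth_leq n k I f : (k <= n)%N -> smooth n I f -> smooth k I f.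
Proof.
move=> kn [fd fc]; split=> [j x jk|j jk]; first exact/fd/leq_trans/kn.
exact/fc/leq_trans/kn.
Qed.

Lemma eq_on_smooth n I f g : open I -> (forall x, I x -> f x = g x) ->
  smooth n I f -> smooth n I g.
Proof.
move=> Io fg [fd fc].
have nfg x k : I x -> \forall y \near x, derive1n k f y = derive1n k g y.
  move=> Ix; apply: near_eq_derive1n; near=> y; apply: fg.
  by near: y; exact: open_near.
split=> [k x kn Ix|k kn x]; first exact: near_eq_derivable (nfg _ _ Ix) (fd _ _ kn Ix).
rewrite inE => Ix; rewrite /continuous_at -(near_eq_derive1n_at k (f := f)); last first.
  by move: (nfg _ 0%N Ix).
apply: cvg_trans (fc k kn x _); last by rewrite inE.
exact/near_eq_cvg/nfg.
Unshelve. all: by end_near. Qed.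

Lemma smoothS n I f df : open I -> (forall x, I x -> is_derive x 1 f (df x)) ->
  smooth n I df -> smooth n.+1 I f.
Proof.
move=> Io fdf dfs.
have {dfs} [dfd dfc] : smooth n I f^`().
  by apply: eq_on_smooth dfs => // x Ix; rewrite (is_derive_derive1 (fdf x Ix)).
split=> [[|k] x kn Ix|[|k] kn x].
- by case: (fdf _ Ix).
- by rewrite derive1Sn; exact: dfd.
- by rewrite inE => Ix; exact: is_derive_continuous (fdf _ Ix).
- by rewrite derive1Sn; exact: dfc.
Qed.

Section closure_properties.
Variable I : set R.
Hypothesis Io : open I.

Lemma smooth_cst n c : smooth n I (fun=> c).
Proof.
elim: n c => [|n IH] c; first by apply: smooth0 => x _; exact: cst_continuous.
apply: (smoothS Io) (IH 0) => x _; exact: is_derive_cst.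
Qed.

Lemma smooth_affine n c d : smooth n I (fun u => c * u + d).
Proof.
case: n => [|n].
  by apply: smooth0 => x _; exact: is_derive_continuous (is_derive_affine _ _ _).
by apply: (smoothS Io) (smooth_cst n c) => x _; exact: is_derive_affine.
Qed.

Lemma smoothD n f g : smooth n I f -> smooth n I g -> smooth n I (fun x => f x + g x).
Proof.
elim: n f g => [|n IH] f g sf sg.
  apply: smooth0 => x Ix; apply: continuousD.
    exact: smooth_continuous sf _ Ix.
  exact: smooth_continuous sg _ Ix.
apply: (smoothS Io) (IH _ _ (smooth_derivative sf) (smooth_derivative sg)) => x Ix.
by apply: is_deriveD_fun; [exact: smooth_is_derive sf _|exact: smooth_is_derive sg _].
Qed.

Lemma smoothM n f g : smooth n I f -> smooth n I g -> smooth n I (fun x => f x * g x).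
Proof.
elim: n f g => [|n IH] f g sf sg.
  apply: smooth0 => x Ix; apply: continuousM.
    exact: smooth_continuous sf _ Ix.
  exact: smooth_continuous sg _ Ix.
have s'f := smooth_leq (leqnSn n) sf; have s'g := smooth_leq (leqnSn n) sg.
apply: (smoothS Io) (smoothD (IH _ _ (smooth_derivative sf) s'g)
                             (IH _ _ s'f (smooth_derivative sg))) => x Ix.
by apply: is_deriveM_fun; [exact: smooth_is_derive sf _|exact: smooth_is_derive sg _].
Qed.

Lemma smoothN n f : smooth n I f -> smooth n I (fun x => - f x).
Proof.
move=> sf; apply: eq_on_smooth (smoothM (smooth_cst n (-1)) sf) => // x _.
by rewrite mulN1r.
Qed.

Lemma smoothB n f g : smooth n I f -> smooth n I g -> smooth n I (fun x => f x - g x).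
Proof. by move=> sf sg; exact: smoothD (smoothN sg). Qed.

Lemma smoothV n f : (forall x, I x -> f x != 0) -> smooth n I f ->
  smooth n I (fun x => (f x)^-1).
Proof.
move=> f0; elim: n => [|n IH] sf.
  apply: smooth0 => x Ix; apply: continuousV; first by apply: f0; rewrite inE in Ix.
  exact: smooth_continuous sf _ Ix.
have iV := IH (smooth_leq (leqnSn n) sf).
apply: (smoothS Io) (smoothM (smoothN (smooth_derivative sf)) (smoothM iV iV)) => x Ix.
apply: is_derive_eq (is_deriveV_fun (f0 _ Ix) (smooth_is_derive sf Ix)) _.
by rewrite expr2 invfM.
Qed.

Lemma smooth_div n f g : (forall x, I x -> g x != 0) ->
  smooth n I f -> smooth n I g -> smooth n I (fun x => f x / g x).
Proof. by move=> g0 sf sg; apply: smoothM => //; exact: smoothV. Qed.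

Lemma smooth_comp n J f m : (forall x, I x -> J (m x)) ->
  smooth n J f -> smooth n I m -> smooth n I (fun x => f (m x)).
Proof.
move=> mJ; elim: n f => [|n IH] f sf sm.
  apply: smooth0 => x Ix; apply: (@continuous_comp _ _ _ m f).
    exact: smooth_continuous sm _ Ix.
  by apply: (smooth_continuous sf); rewrite inE; apply: mJ; rewrite inE in Ix.
have s'm := smooth_leq (leqnSn n) sm.
apply: (smoothS Io) (smoothM (IH _ (smooth_derivative sf) s'm)
                             (smooth_derivative sm)) => x Ix.
apply: is_derive_comp_fun; last exact: smooth_is_derive sm _.
exact: smooth_is_derive sf (mJ _ Ix).
Qed.

End closure_properties.

(** Bootstrapping: m = h^-1 o r satisfies m' = r' / (dh o m), so if m is of class C^k with k <= n,
    then so is m', and m is of class C^(k+1). *)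
Lemma smooth_pinv_comp n V I h dh r : open V -> open I -> is_interval I ->
  (forall x, I x -> is_derive x 1 h (dh x)) -> (forall x, I x -> dh x != 0) ->
  smooth n.+1 V r -> smooth n I dh -> (forall u, V u -> (h @` I) (r u)) ->
  smooth n.+1 V (fun u => pinv I h (r u)).
Proof.
move=> Vo Io Ii hdh dh0 sr sdh rI; set m := fun u => _.
have mP u : V u -> I (m u) /\ h (m u) = r u.
  move=> /rI[x Ix hx]; have <- : x = m u; last by [].
  by rewrite /m -hx pinvKV ?inE//; exact: (derive_neq0_inj Ii hdh).
have mD u : V u -> is_derive u 1 m ((dh (m u))^-1 * derive1 r u).
  move=> Vu; have [Im hm] := mP _ Vu; apply: is_derive_comp_fun.
    by rewrite -hm; exact: is_derive_pinv.
  exact: smooth_is_derive sr Vu.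
(* The trivial bound is generalized together with the order to be proved, while [n] stays fixed in
   the hypotheses. *)
have : (n.+1 <= n.+1)%N by [].
elim: {1 3}n.+1 => [_|k IH kn].
  apply: smooth0 => u; rewrite inE => Vu; exact: is_derive_continuous (mD _ Vu).
apply: (smoothS Vo mD); apply: smoothM => //.
  apply: smoothV => //; first by move=> u /mP[Im _]; exact: dh0.
  apply: (smooth_comp Vo (J := I)); last exact/IH/ltnW.
    by move=> u /mP[].
  exact: smooth_leq sdh.
by apply: smooth_leq (smooth_derivative sr).
Qed.

End smooth.

Section jets.
Context {R : realType}.
Implicit Types (V J : set R) (F G : nat -> R -> R).
Local Notation smooth := continuously_differentiable.

(** A chain of successive derivatives on V. Explicit formulas for the derivatives of products and
    compositions can be chains, and [jet_unique] identifies two chains with the same initial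
    function. *)
Definition jet (n : nat) V F : Prop :=
  forall k u, (k < n)%N -> V u -> is_derive u 1 (F k) (F k.+1 u).

Lemma smooth_jet n V f : smooth n V f -> jet n V (fun k => derive1n k f).
Proof. by move=> [fd _] k u kn Vu; exact: derivable_is_derive (fd k u kn Vu). Qed.

Lemma jet_leq n k V F : (k <= n)%N -> jet n V F -> jet k V F.
Proof. by move=> kn jF j u jk; apply: jF; exact: leq_trans jk kn. Qed.

Lemma jet_unique n V F G : open V -> jet n V F -> jet n V G ->
  (forall u, V u -> F 0%N u = G 0%N u) ->
  forall k u, (k <= n)%N -> V u -> F k u = G k u.
Proof.
move=> Vo jF jG FG0; elim=> [|k IH] u kn Vu; first exact: FG0.
have FG : is_derive u 1 (F k) (G k.+1 u).
  apply: (eq_on_is_derive Vo Vu _ (jG k u kn Vu)) => v Vv.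
  by symmetry; exact: IH (ltnW kn) Vv.
exact: is_derive_unique (jF k u kn Vu) FG.
Qed.

(* [leibniz k i j F G] is the [k]-th derivative of [F i * G j]. *)
Fixpoint leibniz (k i j : nat) F G (u : R) : R :=
  if k is k'.+1 then leibniz k' i.+1 j F G u + leibniz k' i j.+1 F G u
  else F i u * G j u.

(** The two evaluation points may differ, so that jets can be replaced by constant functions
    recording their values at one point. *)
Lemma eq_leibniz F F' G G' (u v : R) :
  (forall i, F i u = F' i v) -> (forall i, G i u = G' i v) ->
  forall k i j, leibniz k i j F G u = leibniz k i j F' G' v.
Proof.
move=> FE GE; elim=> [|k IH] i j /=; first by rewrite FE GE.
by rewrite !IH.
Qed.

Lemma is_derive_leibniz n V F G k i j u : jet n V F -> jet n V G ->
  (k + i < n)%N -> (k + j < n)%N -> V u ->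
  is_derive u 1 (leibniz k i j F G) (leibniz k.+1 i j F G u).
Proof.
move=> jF jG + + Vu; elim: k i j => [|k IH] i j ki kj.
  by apply: is_deriveM_fun; [exact: jF|exact: jG].
rewrite !addSn in ki kj.
by apply: is_deriveD_fun; apply: IH; rewrite ?addnS//; exact: ltnW.
Qed.

Lemma jet_leibniz n V F G : jet n V F -> jet n V G ->
  jet n V (fun k => leibniz k 0 0 F G).
Proof.
by move=> jF jG k u kn Vu; apply: is_derive_leibniz jF jG _ _ Vu; rewrite addn0.
Qed.

(* Faa di Bruno's formula up to order 6. *)
Definition comp_jet F M (k : nat) (u : R) : R :=
  let f i := F i (M 0%N u) in let m i := M i u in
  match k with
  | 0%N => f 0%N
  | 1%N => f 1%N * m 1%N
  | 2%N => f 2%N * m 1%N ^+ 2 + f 1%N * m 2%N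
  | 3%N => f 3%N * m 1%N ^+ 3 + 3 * (f 2%N * (m 1%N * m 2%N)) + f 1%N * m 3%N
  | 4%N => f 4%N * m 1%N ^+ 4 + 6 * (f 3%N * (m 1%N ^+ 2 * m 2%N))
      + 3 * (f 2%N * m 2%N ^+ 2) + 4 * (f 2%N * (m 1%N * m 3%N)) + f 1%N * m 4%N
  | 5%N => f 5%N * m 1%N ^+ 5 + 10 * (f 4%N * (m 1%N ^+ 3 * m 2%N))
      + 15 * (f 3%N * (m 1%N * m 2%N ^+ 2)) + 10 * (f 3%N * (m 1%N ^+ 2 * m 3%N))
      + 10 * (f 2%N * (m 2%N * m 3%N)) + 5 * (f 2%N * (m 1%N * m 4%N))
      + f 1%N * m 5%N
  | _ => f 6%N * m 1%N ^+ 6 + 15 * (f 5%N * (m 1%N ^+ 4 * m 2%N))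
      + 45 * (f 4%N * (m 1%N ^+ 2 * m 2%N ^+ 2)) + 15 * (f 3%N * m 2%N ^+ 3)
      + 20 * (f 4%N * (m 1%N ^+ 3 * m 3%N))
      + 60 * (f 3%N * (m 1%N * (m 2%N * m 3%N))) + 10 * (f 2%N * m 3%N ^+ 2)
      + 15 * (f 3%N * (m 1%N ^+ 2 * m 4%N)) + 15 * (f 2%N * (m 2%N * m 4%N))
      + 6 * (f 2%N * (m 1%N * m 5%N)) + f 1%N * m 6%N
  end.

Lemma is_deriveX_fun n (f : R -> R) (x a : R) : is_derive x 1 f a ->
  is_derive x 1 (fun y => f y ^+ n) (n%:R * f x ^+ n.-1 * a).
Proof.
move=> fa; elim: n => [|n IH].
  have -> : (fun y => f y ^+ 0) = cst 1 by apply/funext => y; rewrite expr0.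
  by rewrite !mul0r; exact: is_derive_cst.
have -> : (fun y => f y ^+ n.+1) = (fun y => f y * f y ^+ n).
  by apply/funext => y; rewrite exprS.
apply: is_derive_eq (is_deriveM_fun fa IH) _; case: n {IH} => [|n] /=.
  by rewrite expr0; ring.
by rewrite exprS -[in RHS]natr1; ring.
Qed.

Lemma jet_comp V J F M : (forall u, V u -> J (M 0%N u)) ->
  jet 6 J F -> jet 6 V M -> jet 6 V (comp_jet F M).
Proof.
move=> MJ jF jM k u k6 Vu.
have dF i : (i < 6)%N ->
    is_derive u 1 (fun v => F i (M 0%N v)) (F i.+1 (M 0%N u) * M 1%N u).
  by move=> i6; apply: is_derive_comp_fun; [exact/jF/MJ|exact: jM].
have dM i : (i < 6)%N -> is_derive u 1 (M i) (M i.+1 u) by move=> i6; exact: jM.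
case: k k6 => [_|[_|[_|[_|[_|[_|//]]]]]]; rewrite /comp_jet;
  (* The value of the derivative is left open and built along the shape of the expression; numerical
     coefficients are tried before general products. [ring] then compares it with the next
     formula. *)
  (notypeclasses refine (@is_derive_eq _ _ _ _ _ _ _ _ _ _);
  [repeat lazymatch goal with
  | |- is_derive _ _ (fun v => @?a v + @?b v) _ =>
      notypeclasses refine (@is_deriveD_fun _ a b _ _ _ _ _)
  | |- is_derive _ _ (fun v => _ %:R * @?b v) _ =>
      notypeclasses refine (@is_derive_cstM _ b _ _ _ _)
  | |- is_derive _ _ (fun v => @?a v * @?b v) _ =>
      notypeclasses refine (@is_deriveM_fun _ a b _ _ _ _ _)
  | |- is_derive _ _ (fun v => (@?a v) ^+ ?n) _ =>
      notypeclasses refine (@is_deriveX_fun n a _ _ _)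
  | |- is_derive _ _ (fun v => F ?i (M 0%N v)) _ => exact: dF i _
  | |- is_derive _ _ (fun v => M ?i v) _ => exact: dM i _
  | |- is_derive _ _ (M ?i) _ => exact: dM i _
  end|]); rewrite /=; ring.
Qed.

End jets.

(** * Algebra of the derivatives at a point *)

Section jet_algebra.
Context {R : realType}.
Implicit Types (F G M : nat -> R -> R) (p q d : nat -> R).

(* If [f'' = P f' + Q f], where [P] and [Q] have the derivatives [p i] and [q i]
   at a point, then [f^(k) = ode_coefk1 p q * f' + ode_coefk0 p q * f] there. *)
Definition ode_coef31 p q := p 1%N + p 0%N ^+ 2 + q 0%N.
Definition ode_coef30 p q := p 0%N * q 0%N + q 1%N.
Definition ode_coef41 p q :=
  p 2%N + 2 * p 1%N * p 0%N + p 0%N * ode_coef31 p q + 2 * q 1%N + q 0%N * p 0%N.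
Definition ode_coef40 p q :=
  2 * p 1%N * q 0%N + p 0%N * ode_coef30 p q + q 2%N + q 0%N ^+ 2.
Definition ode_coef51 p q :=
  p 3%N + 3 * p 2%N * p 0%N + 3 * p 1%N * ode_coef31 p q + p 0%N * ode_coef41 p q
  + 3 * q 2%N + 3 * q 1%N * p 0%N + q 0%N * ode_coef31 p q.
Definition ode_coef50 p q :=
  3 * p 2%N * q 0%N + 3 * p 1%N * ode_coef30 p q + p 0%N * ode_coef40 p q
  + q 3%N + 3 * q 1%N * q 0%N + q 0%N * ode_coef30 p q.
Definition ode_coef61 p q :=
  p 4%N + 4 * p 3%N * p 0%N + 6 * p 2%N * ode_coef31 p q + 4 * p 1%N * ode_coef41 p q
  + p 0%N * ode_coef51 p q + 4 * q 3%N + 6 * q 2%N * p 0%N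
  + 4 * q 1%N * ode_coef31 p q + q 0%N * ode_coef41 p q.
Definition ode_coef60 p q :=
  4 * p 3%N * q 0%N + 6 * p 2%N * ode_coef30 p q + 4 * p 1%N * ode_coef40 p q
  + p 0%N * ode_coef50 p q + q 4%N + 6 * q 2%N * q 0%N
  + 4 * q 1%N * ode_coef30 p q + q 0%N * ode_coef40 p q.

(** These three values come from solving the mean equation order by order. The highest derivative of
    Psi is [q 1] in order 4 and [q 3] in order 6. *)
Definition mean_coef2 p : R := p 0%N / 4.
Definition mean_coef4 p q : R :=
  ode_coef41 p q / 16 - 3 * mean_coef2 p ^+ 2 * p 0%N - 3 / 2 * mean_coef2 p * q 0%N.
Definition mean_coef6 p q : R :=
  ode_coef61 p q / 64 - 15 * p 0%N * mean_coef4 p q * mean_coef2 p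
  - 15 * ode_coef31 p q * mean_coef2 p ^+ 3 - 15 / 4 * mean_coef4 p q * q 0%N
  - 15 / 16 * mean_coef2 p * ode_coef40 p q.

Lemma ode_jet (f p q : nat -> R) :
  (forall k, (k <= 4)%N -> f k.+2 =
    leibniz k 0 0 (fun i => fun=> p i) (fun i => fun=> f i.+1) 0
    + leibniz k 0 0 (fun i => fun=> q i) (fun i => fun=> f i) 0) ->
  [/\ f 2%N = p 0%N * f 1%N + q 0%N * f 0%N,
      f 3%N = ode_coef31 p q * f 1%N + ode_coef30 p q * f 0%N,
      f 4%N = ode_coef41 p q * f 1%N + ode_coef40 p q * f 0%N
    & f 6%N = ode_coef61 p q * f 1%N + ode_coef60 p q * f 0%N].
Proof.
move=> fE.
have f2 : f 2%N = p 0%N * f 1%N + q 0%N * f 0%N by rewrite fE.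
have f3 : f 3%N = ode_coef31 p q * f 1%N + ode_coef30 p q * f 0%N.
  by rewrite fE//= f2 /ode_coef31 /ode_coef30; ring.
have f4 : f 4%N = ode_coef41 p q * f 1%N + ode_coef40 p q * f 0%N.
  by rewrite fE//= f3 f2 /ode_coef41 /ode_coef40; ring.
have f5 : f 5%N = ode_coef51 p q * f 1%N + ode_coef50 p q * f 0%N.
  by rewrite fE//= f4 f3 f2 /ode_coef51 /ode_coef50; ring.
split=> //.
by rewrite fE//= f5 f4 f3 f2 /ode_coef61 /ode_coef60; ring.
Qed.

(* The derivatives at [u] of [u |-> f (x + u / 2) + f (x - u / 2)]. *)
Definition sym_jet (x : R) F (k : nat) (u : R) : R :=
  2^-1 ^+ k * F k (2^-1 * u + x) + (- 2^-1) ^+ k * F k (- 2^-1 * u + x).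

(** At order k the unknown m_k occurs linearly, with coefficient 2 (f' g - f g'), the 2 coming from
    the two terms of the symmetric sum. The odd derivatives vanish since the section is even. *)
Lemma mean_jet (f g m p q : nat -> R) (x : R) :
  f 1%N * g 0%N - f 0%N * g 1%N != 0 ->
  (forall k, (k <= 4)%N -> f k.+2 =
    leibniz k 0 0 (fun i => fun=> p i) (fun i => fun=> f i.+1) 0
    + leibniz k 0 0 (fun i => fun=> q i) (fun i => fun=> f i) 0) ->
  (forall k, (k <= 4)%N -> g k.+2 =
    leibniz k 0 0 (fun i => fun=> p i) (fun i => fun=> g i.+1) 0
    + leibniz k 0 0 (fun i => fun=> q i) (fun i => fun=> g i) 0) ->
  (forall k, (k <= 6)%N ->
    leibniz k 0 0 (comp_jet (fun i => fun=> f i) (fun i => fun=> m i))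
                  (sym_jet x (fun i => fun=> g i)) 0 =
    leibniz k 0 0 (comp_jet (fun i => fun=> g i) (fun i => fun=> m i))
                  (sym_jet x (fun i => fun=> f i)) 0) ->
  [/\ m 2%N = mean_coef2 p, m 4%N = mean_coef4 p q & m 6%N = mean_coef6 p q].
Proof.
move=> w0 /ode_jet[f2 f3 f4 f6] /ode_jet[g2 g3 g4 g6] E.
move: {E} (E 1%N isT) (E 2%N isT) (E 3%N isT) (E 4%N isT) (E 5%N isT) (E 6%N isT).
rewrite /sym_jet /=.
have vanish (a : R) : (f 1%N * g 0%N - f 0%N * g 1%N) * a = 0 -> a = 0.
  by move/eqP; rewrite mulf_eq0 (negbTE w0) => /eqP.
(* Each order is thereby reduced to one identity: the difference of both sides is 2 (f' g - f g')
   times m_k minus its claimed value. *)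
have cancelm (a b c r l : R) : c != 0 -> l = r ->
    c * ((f 1%N * g 0%N - f 0%N * g 1%N) * (a - b)) = l - r -> a = b.
  move=> c0 ->; rewrite subrr => /eqP; rewrite mulf_eq0 (negbTE c0)/= => /eqP/vanish.
  by move/eqP; rewrite subr_eq0 => /eqP.
have two0 : (2 : R) != 0 by rewrite pnatr_eq0.
move=> E1 E2 E3 E4 E5 E6.
have m1 : m 1%N = 0 by apply: cancelm two0 E1 _; field.
rewrite m1 in E2 E3 E4 E5 E6.
have m2 : m 2%N = mean_coef2 p.
  by apply: cancelm two0 E2 _; rewrite f2 g2 /mean_coef2; field.
have m3 : m 3%N = 0 by apply: cancelm two0 E3 _; field.
rewrite m3 in E4 E5 E6.
have m4 : m 4%N = mean_coef4 p q.
  by apply: cancelm two0 E4 _; rewrite f4 g4 f2 g2 /mean_coef4 -m2; field.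
have m5 : m 5%N = 0 by apply: cancelm two0 E5 _; field.
rewrite m5 in E6.
split=> //; apply: cancelm two0 E6 _.
by rewrite f6 g6 f4 g4 f3 g3 f2 g2 /mean_coef6 -m2 -m4; field.
Qed.

(** The hypotheses on [d] are d' = 2 p d and its derivatives. They cancel the terms linear in
    derivatives of [d] and those quadratic in [d], leaving 3/8 of the product in the conclusion; the
    3/8 is the coefficient of -Psi Psi' when Phi = 0. *)
Lemma eq_mean_coef p q d : d 1%N = 2 * p 0%N * d 0%N ->
  d 2%N = 2 * (p 1%N * d 0%N + p 0%N * d 1%N) ->
  d 3%N = 2 * (p 2%N * d 0%N + 2 * (p 1%N * d 1%N) + p 0%N * d 2%N) ->
  mean_coef6 p (fun i => q i - d i) = mean_coef6 p q ->
  d 0%N * (q 1%N - 2 * p 0%N * q 0%N) = 0.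
Proof.
move=> d1 d2 d3 /eqP; rewrite -subr_eq0 => /eqP H.
have -> : d 0%N * (q 1%N - 2 * p 0%N * q 0%N) =
    8 / 3 * (mean_coef6 p (fun i => q i - d i) - mean_coef6 p q).
  rewrite /mean_coef6 /mean_coef4 /mean_coef2 /ode_coef61 /ode_coef51 /ode_coef41.
  by rewrite /ode_coef40 /ode_coef31 /ode_coef30 d3 d2 d1; field.
by rewrite H mulr0.
Qed.

(** [q] enters [mean_coef4] only through (q 1 - 2 p 0 q 0) / 8. *)
Lemma mean_coef4_eq p q r : mean_coef4 p q = mean_coef4 p r ->
  q 1%N - r 1%N = 2 * p 0%N * (q 0%N - r 0%N).
Proof.
rewrite /mean_coef4 /mean_coef2 /ode_coef41 /ode_coef31 => /eqP.
rewrite -subr_eq0 => /eqP H; apply/eqP; rewrite -subr_eq0; apply/eqP.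
by rewrite -[RHS](mulr0 8) -[in RHS]H; field.
Qed.

End jet_algebra.

(** * The mean of a pair and its derivatives on the diagonal *)

Section pair.
Context {R : realType}.
Variables (I : set R) (f g : R -> R) (n : nat).
Hypotheses (I_open : open I) (I_interval : is_interval I).
Hypothesis fgC : class_C n.+2 I f g.
Local Notation smooth := continuously_differentiable.
Local Notation mu := (half_dirac : probability (measurableTypeR R) R).
Local Notation w := (wronskian 1 0 f g).

Lemma class_C_smooth1 : smooth n.+2 I f. Proof. by case: fgC. Qed.
Lemma class_C_smooth2 : smooth n.+2 I g. Proof. by case: fgC. Qed.
Lemma class_C_gt0 x : I x -> 0 < g x. Proof. by case: fgC => _ _ + _; exact. Qed.
Lemma class_C_neq0 x : I x -> g x != 0.
Proof. by move=> /class_C_gt0; rewrite lt0r => /andP[]. Qed.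
Lemma wronskian_neq0 x : I x -> w x != 0. Proof. by case: fgC => _ _ _; exact. Qed.

Lemma is_derive_pair1 x : I x -> is_derive x 1 f (derive1 f x).
Proof. exact: smooth_is_derive class_C_smooth1. Qed.
Lemma is_derive_pair2 x : I x -> is_derive x 1 g (derive1 g x).
Proof. exact: smooth_is_derive class_C_smooth2. Qed.

Lemma is_derive_ratio x : I x ->
  is_derive x 1 (fun s => f s / g s) (w x / g x ^+ 2).
Proof.
move=> Ix; have gx := class_C_neq0 Ix.
exact: is_derive_div gx (is_derive_pair1 Ix) (is_derive_pair2 Ix).
Qed.

Lemma derive_ratio_neq0 x : I x -> w x / g x ^+ 2 != 0.
Proof.
move=> Ix; rewrite mulf_eq0 negb_or wronskian_neq0//= invr_eq0 expf_eq0/=.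
exact: class_C_neq0.
Qed.

Lemma ratio_inj : {in I &, injective (fun s => f s / g s)}.
Proof.
exact: (derive_neq0_inj I_interval is_derive_ratio derive_ratio_neq0).
Qed.

Lemma meanE x y : I x -> I y ->
  mean I f g mu x y = pinv I (fun s => f s / g s) ((f x + f y) / (g x + g y)).
Proof.
move=> Ix Iy; have [fc gc] : {in I, continuous f} /\ {in I, continuous g}.
  by split; [exact: smooth_continuous class_C_smooth1
            |exact: smooth_continuous class_C_smooth2].
rewrite /mean !(Rintegral_half_dirac_segment I_interval)//; congr pinv.
have gx := class_C_gt0 Ix; have gy := class_C_gt0 Iy.
by field; lra.
Qed.

(** The quotient is the average of f x / g x and f y / g y with the positive weights g x and g y,
    hence lies between them. *)
Lemma mean_value_in_range x y : I x -> I y ->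
  ((fun s => f s / g s) @` I) ((f x + f y) / (g x + g y)).
Proof.
move=> Ix Iy; have gx := class_C_gt0 Ix; have gy := class_C_gt0 Iy.
have [||z Iz zE] := @IVT_on _ I I_interval (fun s => f s / g s) x y
    ((f x + f y) / (g x + g y)) _ Ix Iy.
- by move=> t; rewrite inE => It; exact: is_derive_continuous (is_derive_ratio It).
- have fE (a b : R) : 0 < b -> a = a / b * b by move=> b0; rewrite divfK// gt_eqF.
  have := fE (f x) _ gx; have := fE (f y) _ gy.
  move: (f x / g x) (f y / g y) => a b -> ->.
  rewrite ge_min le_max !ler_pdivlMr ?addr_gt0// !ler_pdivrMr ?addr_gt0//.
  have [ab|/ltW ba] := leP a b; apply/andP; split; apply/orP.
  + by left; nra.
  + by right; nra.
  + by right; nra.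
  + by left; nra.
- by exists z.
Qed.

Lemma mean_spec x y : I x -> I y -> I (mean I f g mu x y) /\
  f (mean I f g mu x y) * (g x + g y) = g (mean I f g mu x y) * (f x + f y).
Proof.
move=> Ix Iy; rewrite meanE//; have [z Iz zE] := mean_value_in_range Ix Iy.
rewrite -zE pinvKV ?inE//; last exact: ratio_inj.
split=> //; have gx := class_C_gt0 Ix; have gy := class_C_gt0 Iy.
have gz := class_C_neq0 Iz; have gxy : g x + g y != 0 by lra.
have -> : f z = (f x + f y) / (g x + g y) * g z by rewrite -zE divfK.
by field.
Qed.

(** With [mean_spec], this characterizes the mean by a polynomial equation, the form in which all
    means are compared below. *)
Lemma mean_unique x y z : I x -> I y -> I z ->
  f z * (g x + g y) = g z * (f x + f y) -> mean I f g mu x y = z.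
Proof.
move=> Ix Iy Iz E; rewrite meanE//; have <- : pinv I (fun s => f s / g s) (f z / g z) = z.
  by rewrite (pinvKV (fun=> point) ratio_inj)// inE.
congr pinv; have gx := class_C_gt0 Ix; have gy := class_C_gt0 Iy.
have gz := class_C_neq0 Iz; have gxy : g x + g y != 0 by lra.
by apply/eqP; rewrite eqr_div// [X in _ == X]E mulrC.
Qed.

Lemma smooth_wronskian i j k : (i + k <= n.+2)%N -> (j + k <= n.+2)%N ->
  smooth k I (wronskian i j f g).
Proof.
have sd h m : smooth n.+2 I h -> (m + k <= n.+2)%N -> smooth k I (derive1n m h).
  move=> [hd hc] mk; split=> [l x lk Ix|l lk]; rewrite /derive1n -iterD.
    by apply: hd => //; apply: leq_trans mk; rewrite addnC ltn_add2l.
  by apply: hc; apply: leq_trans mk; rewrite addnC leq_add2l.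
move=> ik jk.
have sfi := sd _ _ class_C_smooth1 ik; have sfj := sd _ _ class_C_smooth1 jk.
have sgi := sd _ _ class_C_smooth2 ik; have sgj := sd _ _ class_C_smooth2 jk.
exact: (smoothB I_open (smoothM I_open sfi sgj) (smoothM I_open sfj sgi)).
Qed.

Let le2 : (2 + n <= n.+2)%N. Proof. exact: leqnn. Qed.
Let le1 : (1 + n <= n.+2)%N. Proof. exact: leqnSn. Qed.
Let le0 : (0 + n <= n.+2)%N. Proof. exact/leqW/leqnSn. Qed.

Lemma smooth_Phi : smooth n I (Phi f g).
Proof.
exact: (smooth_div I_open wronskian_neq0
          (smooth_wronskian le2 le0) (smooth_wronskian le1 le0)).
Qed.

Lemma smooth_Psi : smooth n I (Psi f g).
Proof.
exact: (smoothN I_open (smooth_div I_open wronskian_neq0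
          (smooth_wronskian le2 le1) (smooth_wronskian le1 le0))).
Qed.

(** Cramer's rule: Phi and Psi are the coefficients that express the second derivatives of f and g
    by their first derivatives and values, with determinant w. *)
Lemma pair_ode1 x : I x ->
  derive1n 2 f x = Phi f g x * derive1n 1 f x + Psi f g x * f x.
Proof.
move=> Ix; have := wronskian_neq0 Ix.
rewrite /Phi /Psi /wronskian !derive1n0.
move: (derive1n 2 f x) (derive1n 2 g x) (derive1n 1 f x) (derive1n 1 g x) => f2 g2 f1 g1.
by move: (f x) (g x) => f0 g0 w0; field.
Qed.

Lemma pair_ode2 x : I x ->
  derive1n 2 g x = Phi f g x * derive1n 1 g x + Psi f g x * g x.
Proof.
move=> Ix; have := wronskian_neq0 Ix.
rewrite /Phi /Psi /wronskian !derive1n0.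
move: (derive1n 2 f x) (derive1n 2 g x) (derive1n 1 f x) (derive1n 1 g x) => f2 g2 f1 g1.
by move: (f x) (g x) => f0 g0 w0; field.
Qed.

(** Abel's identity; the products f' g' cancel in the derivative of f' g - f g'. *)
Lemma is_derive_wronskian x : I x -> is_derive x 1 w (Phi f g x * w x).
Proof.
move=> Ix; have w0 := wronskian_neq0 Ix.
have jf := smooth_jet class_C_smooth1; have jg := smooth_jet class_C_smooth2.
apply: is_derive_eq (is_deriveB_fun
  (is_deriveM_fun (jf 1%N _ isT Ix) (jg 0%N _ isT Ix))
  (is_deriveM_fun (jf 0%N _ isT Ix) (jg 1%N _ isT Ix))) _.
rewrite /Phi divfK// /wronskian !derive1n0 !derive1nS.
by move: (derive1 _ x) (derive1 _ x) (derive1 _ x) (derive1 _ x) => f2 g2 f1 g1; ring.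
Qed.

End pair.

(** * Derivatives of the section of the mean at the origin *)

Section mean_section_jet.
Context {R : realType}.
Variables (I : set R) (f g : R -> R).
Hypotheses (I_open : open I) (I_interval : is_interval I).
Hypothesis fgC : class_C 6 I f g.
Local Notation smooth := continuously_differentiable.
Local Notation mu := (half_dirac : probability (measurableTypeR R) R).

Let half_right (x u : R) := 2^-1 * u + x.
Let half_left (x u : R) := - 2^-1 * u + x.
Let dom (x : R) : set R := half_right x @^-1` I `&` half_left x @^-1` I.

Lemma mean_sectionE x u :
  mean_section I f g mu x u = mean I f g mu (2^-1 * u + x) (- 2^-1 * u + x).
Proof.
rewrite /mean_section first_moment_half_dirac.
have -> : x + (1 - 2^-1) * u = 2^-1 * u + x by lra.
by have -> : x - 2^-1 * u = - 2^-1 * u + x by lra.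
Qed.

Let open_dom x : open (dom x).
Proof.
apply: openI; apply: open_comp => // t _.
- exact: is_derive_continuous (is_derive_affine 2^-1 x t).
- exact: is_derive_continuous (is_derive_affine (- 2^-1) x t).
Qed.

Let smooth_sym x (h : R -> R) : smooth 6 I h ->
  smooth 6 (dom x) (fun u => h (2^-1 * u + x) + h (- 2^-1 * u + x)).
Proof.
move=> sh.
have sa := @smooth_affine _ _ (@open_dom x) 6.
have s1 := @smooth_comp _ _ (@open_dom x) 6 I h _ (fun u Vu => Vu.1) sh (sa 2^-1 x).
have s2 := @smooth_comp _ _ (@open_dom x) 6 I h _ (fun u Vu => Vu.2) sh (sa (- 2^-1) x).
exact: (smoothD (@open_dom x) s1 s2).
Qed.

(** The derivative w / g^2 of f / g is only of class C^5, but inversion gains one order, so the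
    section is of class C^6. *)
Lemma smooth_mean_section x : smooth 6 (dom x) (mean_section I f g mu x).
Proof.
have [sf sg] := (class_C_smooth1 fgC, class_C_smooth2 fgC).
pose D u := g (2^-1 * u + x) + g (- 2^-1 * u + x).
pose N u := f (2^-1 * u + x) + f (- 2^-1 * u + x).
have D0 u : dom x u -> D u != 0.
  move=> [Iu Iv]; rewrite gt_eqF// /D addr_gt0//.
    exact: (class_C_gt0 fgC Iu).
  exact: (class_C_gt0 fgC Iv).
have : smooth 6 (dom x) (fun u => pinv I (fun s => f s / g s) (N u / D u)).
  apply: (smooth_pinv_comp (@open_dom x) I_open I_interval (is_derive_ratio fgC)
    (derive_ratio_neq0 fgC)).
  - by apply: smooth_div => //; exact: smooth_sym.
  - apply: smooth_div => //; first by move=> t It; rewrite expf_neq0// (class_C_neq0 fgC).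
      exact: (smooth_wronskian I_open fgC).
    have sg' := smooth_leq (isT : (5 <= 6)%N) sg.
    by apply: (eq_on_smooth I_open _ (smoothM I_open sg' sg')) => t _; rewrite expr2.
  - by move=> u [Iu Iv]; exact: (mean_value_in_range I_interval fgC).
apply: eq_on_smooth => // u [Iu Iv].
by rewrite mean_sectionE (meanE I_interval fgC).
Qed.

Let jet_sym x (F : nat -> R -> R) : jet 6 I F -> jet 6 (dom x) (sym_jet x F).
Proof.
move=> jF k u k6 [Iu Iv].
have dr c y : is_derive (c * u + x) 1 (F k) y ->
    is_derive u 1 (fun v => F k (c * v + x)) (y * c).
  by move=> ?; exact: is_derive_comp_fun (is_derive_affine c x u).
apply: is_derive_eq (is_deriveD_fun
  (is_derive_cstM _ (dr _ _ (jF k _ k6 Iu)))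
  (is_derive_cstM _ (dr _ _ (jF k _ k6 Iv)))) _.
by rewrite /sym_jet !exprSr; ring.
Qed.

(** The equation says that two jets of length 4 start with the same function; by uniqueness it may
    be differentiated four times. *)
Let ode_leibniz (h : R -> R) x : smooth 6 I h ->
  (forall t, I t -> derive1n 2 h t = Phi f g t * derive1n 1 h t + Psi f g t * h t) ->
  I x -> forall k, (k <= 4)%N -> derive1n k.+2 h x =
    leibniz k 0 0 (fun i => fun=> derive1n i (Phi f g) x)
                  (fun i => fun=> derive1n i.+1 h x) 0
    + leibniz k 0 0 (fun i => fun=> derive1n i (Psi f g) x)
                    (fun i => fun=> derive1n i h x) 0.
Proof.
move=> sh hE Ix k k4; have jh := smooth_jet sh.
have jP := smooth_jet (smooth_Phi I_open fgC).
have jQ := smooth_jet (smooth_Psi I_open fgC).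
have shift m l : (l + m <= 6)%N -> jet l I (fun i => derive1n (i + m) h).
  by move=> lm i u il; apply: jh; apply: leq_trans lm; rewrite ltn_add2r.
have j1 := shift 1%N 4%N isT; have j0 := shift 0%N 4%N isT.
have jR : jet 4 I (fun k u =>
    leibniz k 0 0 (fun i => derive1n i (Phi f g)) (fun i => derive1n (i + 1) h) u +
    leibniz k 0 0 (fun i => derive1n i (Psi f g)) (fun i => derive1n (i + 0) h) u).
  by move=> i u i4 Iu; apply: is_deriveD_fun; apply: jet_leibniz i4 Iu.
have := jet_unique I_open (shift 2%N 4%N isT) jR hE k4 Ix; rewrite addn2 => ->.
by congr (_ + _); apply: eq_leibniz => i; rewrite ?addn0 ?addn1.
Qed.

Lemma derive_mean_section x : I x ->
  [/\ derive1n 2 (mean_section I f g mu x) 0 =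
        mean_coef2 (fun k => derive1n k (Phi f g) x),
      derive1n 4 (mean_section I f g mu x) 0 =
        mean_coef4 (fun k => derive1n k (Phi f g) x) (fun k => derive1n k (Psi f g) x)
    & derive1n 6 (mean_section I f g mu x) 0 =
        mean_coef6 (fun k => derive1n k (Phi f g) x) (fun k => derive1n k (Psi f g) x)].
Proof.
move=> Ix; have [sf sg] := (class_C_smooth1 fgC, class_C_smooth2 fgC).
have x0 : dom x 0 by split; rewrite /= /half_right /half_left mulr0 add0r.
have dom_mean u : dom x u -> I (mean_section I f g mu x u) /\
    f (mean_section I f g mu x u) * sym_jet x (fun k => derive1n k g) 0 u =
    g (mean_section I f g mu x u) * sym_jet x (fun k => derive1n k f) 0 u.
  move=> [Iu Iv]; have := mean_spec I_interval fgC Iu Iv.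
  by rewrite mean_sectionE /sym_jet !expr0 !mul1r.
have m0 : mean_section I f g mu x 0 = x.
  rewrite mean_sectionE !mulr0 !add0r.
  by apply: (mean_unique I_interval fgC) => //; ring.
have jm := smooth_jet (smooth_mean_section x).
have jL (h k : R -> R) : smooth 6 I h -> smooth 6 I k -> jet 6 (dom x) (fun i =>
    leibniz i 0 0 (comp_jet (fun k => derive1n k h)
                     (fun k => derive1n k (mean_section I f g mu x)))
                  (sym_jet x (fun i => derive1n i k))).
  move=> sh sk; apply: jet_leibniz; last exact/jet_sym/smooth_jet.
  by apply: jet_comp (smooth_jet sh) jm => u /dom_mean[].
have E := jet_unique (@open_dom x) (jL _ _ sf sg) (jL _ _ sg sf)
  (fun u xu => (dom_mean u xu).2).
apply: (@mean_jet _ (fun k => derive1n k f x) (fun k => derive1n k g x)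
          (fun k => derive1n k (mean_section I f g mu x) 0) _ _ x).
- exact: (wronskian_neq0 fgC Ix).
- exact: ode_leibniz sf (pair_ode1 fgC) Ix.
- exact: ode_leibniz sg (pair_ode2 fgC) Ix.
- move=> k k6.
  (* At u = 0 both arguments x + u / 2 and x - u / 2, and the section itself, equal [x]; every jet
     may be frozen to its values there, as [mean_jet] expects. *)
  have LE (h1 h2 : R -> R) : leibniz k 0 0 (comp_jet (fun k => derive1n k h1)
        (fun k => derive1n k (mean_section I f g mu x)))
        (sym_jet x (fun i => derive1n i h2)) 0 =
      leibniz k 0 0 (comp_jet (fun i => fun=> derive1n i h1 x)
        (fun i => fun=> derive1n i (mean_section I f g mu x) 0))
        (sym_jet x (fun i => fun=> derive1n i h2 x)) 0.
    apply: eq_leibniz => i; last by rewrite /sym_jet !mulr0 !add0r.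
    have e : derive1n 0 (mean_section I f g mu x) 0 = x by [].
    by rewrite /comp_jet e.
  exact: etrans (esym (LE f g)) (etrans (E k 0 k6 x0) (LE g f)).
Qed.

End mean_section_jet.

(** * Identities on a dense subset *)

Section dense_extension.
Context {R : realType}.

Lemma dense_eq0 (I V : set R) (h : R -> R) : {in I, continuous h} ->
  I `<=` closure V -> (forall x, V x -> h x = 0) -> forall x, I x -> h x = 0.
Proof.
move=> hc IV hV x Ix; apply: contrapT => /eqP hx.
have /(_ _)/= := hc x; rewrite inE => /(_ Ix) hcx.
have N : \forall y \near x, h y != 0 by exact: (@cvgr_neq0 _ _ _ _ _ h _ hcx).
by have [y [Vy /eqP]] := IV _ Ix _ N; rewrite hV.
Qed.

End dense_extension.

(** * The linear equation of second order attached to a pair *)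

Section ode.
Context {R : realType}.
Variables (I : set R) (f g : R -> R).
Hypotheses (I_nonempty : I !=set0) (I_open : open I) (I_interval : is_interval I).
Hypothesis fgC : class_C 2 I f g.
Local Notation smooth := continuously_differentiable.
Local Notation w := (wronskian 1 0 f g).

(** Since w' = Phi w, the quotient y / w^k has derivative zero. The case k = 1 serves Wronskians,
    the case k = 2 serves Psi and the difference of two Psi. *)
Lemma proportional_wronskian (k : nat) (y : R -> R) :
  (forall x, I x -> is_derive x 1 y (k%:R * Phi f g x * y x)) ->
  exists c, forall x, I x -> y x = c * w x ^+ k.
Proof.
move=> dy; have [a Ia] := I_nonempty; exists (y a / w a ^+ k) => x Ix.
have w0 := wronskian_neq0 fgC.
have -> : y a / w a ^+ k = y x / w x ^+ k; last by rewrite divfK// expf_neq0// w0.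
apply: (derive0_cst I_interval (f := fun t => y t / w t ^+ k)) => // t It.
have wk0 : w t ^+ k != 0 by rewrite expf_neq0// w0.
apply: is_derive_eq (@is_derive_div _ y (fun t => w t ^+ k) _ _ _ wk0 (dy _ It)
  (is_deriveX_fun k (is_derive_wronskian fgC It))) _.
case: k wk0 {dy} => [|k] wk0 /=; first by ring.
by rewrite exprS; ring.
Qed.

Lemma is_derive_cross (u v : R -> R) x : smooth 2 I u -> smooth 2 I v -> I x ->
  derive1n 2 u x = Phi f g x * derive1n 1 u x + Psi f g x * u x ->
  derive1n 2 v x = Phi f g x * derive1n 1 v x + Psi f g x * v x ->
  is_derive x 1 (wronskian 1 0 u v) (Phi f g x * wronskian 1 0 u v x).
Proof.
move=> su sv Ix; have ju := smooth_jet su; have jv := smooth_jet sv => uE vE.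
apply: is_derive_eq (is_deriveB_fun
  (is_deriveM_fun (ju 1%N _ isT Ix) (jv 0%N _ isT Ix))
  (is_deriveM_fun (ju 0%N _ isT Ix) (jv 1%N _ isT Ix))) _.
rewrite uE vE /wronskian !derive1n0.
by move: (derive1n 1 u x) (derive1n 1 v x) (Phi _ _ _) (Psi _ _ _) => *; ring.
Qed.

(** W(F, g) and W(f, F) are constant multiples a w and b w by Abel's identity, and w F = W(F, g) f +
    W(f, F) g holds algebraically. *)
Lemma ode_solution (F : R -> R) : smooth 2 I F ->
  (forall x, I x -> derive1n 2 F x = Phi f g x * derive1n 1 F x + Psi f g x * F x) ->
  exists a b, forall x, I x -> F x = a * f x + b * g x.
Proof.
move=> sF FE; have [sf sg] := (class_C_smooth1 fgC, class_C_smooth2 fgC).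
have [|a aE] := @proportional_wronskian 1 (wronskian 1 0 F g).
  move=> x Ix; rewrite mul1r; apply: is_derive_cross => //; first exact: FE.
  exact: (pair_ode2 fgC).
have [|b bE] := @proportional_wronskian 1 (wronskian 1 0 f F).
  move=> x Ix; rewrite mul1r; apply: is_derive_cross => //; last exact: FE.
  exact: (pair_ode1 fgC).
exists a, b => x Ix; apply: (mulfI (wronskian_neq0 fgC Ix)).
move: (aE x Ix) (bE x Ix); rewrite expr1.
have -> : w x * (a * f x + b * g x) = a * w x * f x + b * w x * g x by ring.
move=> <- <-; rewrite /wronskian !derive1n0.
by move: (derive1n 1 F x) (derive1n 1 f x) (derive1n 1 g x) => *; ring.
Qed.

Lemma wronskian_comb (F G : R -> R) (a b c d : R) :
  (forall x, I x -> F x = a * f x + b * g x /\ G x = c * f x + d * g x) ->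
  forall x, I x -> wronskian 1 0 F G x = (a * d - b * c) * w x.
Proof.
move=> E x Ix.
have D (H : R -> R) (p q : R) : (forall x, I x -> H x = p * f x + q * g x) ->
    derive1n 1 H x = p * derive1n 1 f x + q * derive1n 1 g x.
  move=> HE; apply: is_derive_derive1.
  apply: (eq_on_is_derive I_open Ix (fun y Iy => esym (HE y Iy))).
  apply: is_deriveD_fun; apply: is_derive_cstM.
    exact: (is_derive_pair1 fgC).
  exact: (is_derive_pair2 fgC).
rewrite /wronskian !derive1n0 (D F a b) ?(D G c d); try by move=> y /E[].
have [-> ->] := E x Ix.
by move: (derive1n 1 f x) (derive1n 1 g x) => *; ring.
Qed.

Lemma equivalent_of_ode (F G : R -> R) : class_C 2 I F G ->
  (forall x, I x -> Phi f g x = Phi F G x) ->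
  (forall x, I x -> Psi f g x = Psi F G x) ->
  equivalent_pairs I f g F G.
Proof.
move=> FGC PE QE.
have [a [b FE]] : exists a b, forall x, I x -> F x = a * f x + b * g x.
  apply: ode_solution => [|x Ix]; first exact: class_C_smooth1 FGC.
  by rewrite PE// QE//; exact: pair_ode1 FGC _ Ix.
have [c [d GE]] : exists a b, forall x, I x -> G x = a * f x + b * g x.
  apply: ode_solution => [|x Ix]; first exact: class_C_smooth2 FGC.
  by rewrite PE// QE//; exact: pair_ode2 FGC _ Ix.
exists a, b, c, d; split; last by move=> x Ix; rewrite FE// GE.
(* The Wronskian of (F, G) is (a d - b c) w and vanishes nowhere, so the determinant is nonzero. *)
have [x Ix] := I_nonempty; have := wronskian_neq0 FGC Ix.
rewrite (@wronskian_comb _ _ a b c d)//; last by move=> y Iy; rewrite FE// GE.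
by apply: contra_neq => ->; rewrite subrr mul0r.
Qed.

End ode.

(** * Consequences of equal derivatives on a dense subset *)

Section mean_derivatives.
Context {R : realType}.
Variables (I : set R) (f g F G : R -> R).
Hypotheses (I_nonempty : I !=set0) (I_open : open I) (I_interval : is_interval I).
Hypotheses (fgC : class_C 6 I f g) (FGC : class_C 6 I F G).
Local Notation smooth := continuously_differentiable.
Local Notation mu := (half_dirac : probability (measurableTypeR R) R).

Lemma class_C_leq m n (u v : R -> R) : (m <= n)%N -> class_C n I u v -> class_C m I u v.
Proof. by move=> mn [su sv ? ?]; split=> //; exact: smooth_leq mn _. Qed.

Variable V : set R.
Hypotheses (VI : V `<=` I) (V_dense : I `<=` closure V).
Hypothesis derive_eq : forall x, V x ->
  [/\ derive1n 2 (mean_section I f g mu x) 0 = derive1n 2 (mean_section I F G mu x) 0,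
      derive1n 4 (mean_section I f g mu x) 0 = derive1n 4 (mean_section I F G mu x) 0
    & derive1n 6 (mean_section I f g mu x) 0 = derive1n 6 (mean_section I F G mu x) 0].

Let sP := smooth_Phi I_open fgC.
Let sQ1 := smooth_Psi I_open fgC.
Let sQ2 := smooth_Psi I_open FGC.

Lemma dense_eq0_smooth n h : smooth n I h -> (forall x, V x -> h x = 0) ->
  forall x, I x -> h x = 0.
Proof. by move=> sh; apply: dense_eq0 V_dense; exact: smooth_continuous sh. Qed.

Lemma Phi_eq x : I x -> Phi f g x = Phi F G x.
Proof.
move=> Ix; apply/eqP; rewrite -subr_eq0; apply/eqP; move: x Ix.
apply: (dense_eq0_smooth (smoothB I_open sP (smooth_Phi I_open FGC))) => x Vx.
have Ix := VI Vx; have [D2 _ _] := derive_eq Vx; move: D2.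
have [-> _ _] := derive_mean_section I_open I_interval fgC Ix.
have [-> _ _] := derive_mean_section I_open I_interval FGC Ix.
by rewrite /mean_coef2 !derive1n0; lra.
Qed.

Let coefs_eq x : V x ->
  let p k := derive1n k (Phi f g) x in
  mean_coef4 p (fun k => derive1n k (Psi f g) x) =
    mean_coef4 p (fun k => derive1n k (Psi F G) x) /\
  mean_coef6 p (fun k => derive1n k (Psi f g) x) =
    mean_coef6 p (fun k => derive1n k (Psi F G) x).
Proof.
move=> Vx p; have Ix := VI Vx; have [_ D4 D6] := derive_eq Vx; move: D4 D6.
have [_ -> ->] := derive_mean_section I_open I_interval fgC Ix.
have [_ -> ->] := derive_mean_section I_open I_interval FGC Ix.
have -> // : (fun k => derive1n k (Phi F G) x) = p.
apply/funext => k; apply: near_eq_derive1n_at.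
near=> y; symmetry; apply: Phi_eq; near: y; exact: open_near.
Unshelve. all: by end_near. Qed.

Let D (k : nat) (x : R) := derive1n k (Psi f g) x - derive1n k (Psi F G) x.

Let jD : jet 4 I D.
Proof.
move=> k u k4 Iu; apply: is_deriveB_fun.
  exact: smooth_jet sQ1 _ _ k4 Iu.
exact: smooth_jet sQ2 _ _ k4 Iu.
Qed.

Let D1E x : I x -> D 1 x = 2 * Phi f g x * D 0 x.
Proof.
move=> Ix; apply/eqP; rewrite -subr_eq0; apply/eqP; move: x Ix.
have sD : smooth 3 I (fun x => D 1 x - 2 * Phi f g x * D 0 x).
  have le34 : (3 <= 4)%N by [].
  apply: smoothB => //.
    by apply: smoothB => //; exact: smooth_derivative.
  apply: smoothM => //.
    by apply: smoothM => //; [exact: smooth_cst|exact: smooth_leq le34 sP].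
  by apply: smoothB => //; [exact: smooth_leq le34 sQ1|exact: smooth_leq le34 sQ2].
apply: (dense_eq0_smooth sD) => x Vx; have [/mean_coef4_eq E _] := coefs_eq Vx.
by apply/eqP; rewrite subr_eq0 /D E.
Qed.

(** Differentiates D' = 2 Phi D, to supply the second and third derivatives of D that the comparison
    at order 6 requires. *)
Let D_jet x k : I x -> (k <= 3)%N ->
  D k.+1 x = 2 * leibniz k 0 0 (fun i => derive1n i (Phi f g)) D x.
Proof.
move=> Ix k3.
have j1 : jet 3 I (fun i => D i.+1) by move=> i u i3 Iu; exact: jD.
have j2 : jet 3 I (fun i u => 2 * leibniz i 0 0 (fun i => derive1n i (Phi f g)) D u).
  move=> i u i3 Iu; apply: is_derive_cstM.
  have le34 : (3 <= 4)%N by [].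
  exact: (jet_leibniz (jet_leq le34 (smooth_jet sP)) (jet_leq le34 jD)).
apply: (jet_unique I_open j1 j2) k3 Ix => u Iu.
by rewrite D1E//= mulrA.
Qed.

Let D_Psi x : I x ->
  D 0 x * (derive1 (Psi f g) x - 2 * Phi f g x * Psi f g x) = 0.
Proof.
move: x.
have le34 : (3 <= 4)%N by [].
have sQ1' := smooth_leq le34 sQ1; have sQ2' := smooth_leq le34 sQ2.
have sP' := smooth_leq le34 sP.
have sE : smooth 3 I (fun x => D 0 x * (derive1 (Psi f g) x - 2 * Phi f g x * Psi f g x)).
  apply: smoothM => //; first exact: (smoothB I_open sQ1' sQ2').
  apply: smoothB => //; first exact: smooth_derivative.
  apply: smoothM => //; apply: smoothM => //; exact: smooth_cst.
apply: (dense_eq0_smooth sE) => x Vx; have Ix := VI Vx; have [_ E] := coefs_eq Vx.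
apply: (@eq_mean_coef _ (fun k => derive1n k (Phi f g) x)
  (fun k => derive1n k (Psi f g) x) (fun k => D k x)).
- exact: D1E.
- by rewrite D_jet//=; ring.
- by rewrite D_jet//=; ring.
- by apply: etrans (esym E); congr mean_coef6; apply/funext => k; rewrite /D; ring.
Qed.

(** Because D = k w^2 with k constant, D vanishes either everywhere or nowhere on I. In the second
    case it can be cancelled from D (Psi' - 2 Phi Psi) = 0 at every point, which makes the
    alternative global. *)
Lemma alternative_of_mean_derivatives : equivalent_pairs I f g F G \/
  (forall x, I x -> Phi f g x = Phi F G x) /\
  exists alpha beta : R, forall x, I x ->
    Psi f g x = alpha * wronskian 1 0 f g x ^+ 2 /\
    Psi F G x = beta * wronskian 1 0 f g x ^+ 2.
Proof.
have le26 : (2 <= 6)%N by [].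
have fgC2 := class_C_leq le26 fgC; have FGC2 := class_C_leq le26 FGC.
have [|k kE] := proportional_wronskian I_nonempty I_interval fgC2 (k := 2) (y := D 0).
  by move=> x Ix; rewrite -D1E//; exact: jD.
have [k0|k0] := eqVneq k 0.
  left; apply: (equivalent_of_ode I_nonempty I_open I_interval fgC2 FGC2 Phi_eq) => x Ix.
  by apply/eqP; rewrite -subr_eq0 -[_ - _]/(D 0 x) kE// k0 mul0r.
right; split; first exact: Phi_eq.
have [|al alE] := proportional_wronskian I_nonempty I_interval fgC2 (k := 2) (y := Psi f g).
  move=> x Ix; apply: is_derive_eq (smooth_is_derive sQ1 Ix) _.
  have := D_Psi Ix; move/eqP; rewrite mulf_eq0 kE// mulf_eq0 (negbTE k0)/=.
  by rewrite expf_eq0 (negbTE (wronskian_neq0 fgC Ix))/= subr_eq0 => /eqP.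
exists al, (al - k) => x Ix; split; first exact: alE.
have := kE x Ix; rewrite mulrBl -alE// => <-.
by rewrite /D !derive1n0; ring.
Qed.

End mean_derivatives.

(** * Trigonometric pairs *)

Section trigonometric_pairs.
Context {R : realType}.
Implicit Types (t x y : R).

Lemma is_derive_expRN x : is_derive x 1 (fun y : R => expR (- y)) (- expR (- x)).
Proof.
apply: is_derive_eq (is_derive_comp_fun (is_derive_expR (- x))
  (is_deriveN_fun (is_derive_id x 1))) _.
by rewrite mulrN1.
Qed.

Lemma is_derive_sinh x : is_derive x 1 (@sinh R) (cosh x).
Proof.
rewrite /sinh /cosh; apply: is_derive_eq (is_deriveM_cst 2^-1
  (is_deriveB_fun (is_derive_expR x) (is_derive_expRN x))) _.
by rewrite opprK.
Qed.

Lemma is_derive_cosh x : is_derive x 1 (@cosh R) (sinh x).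
Proof.
rewrite /sinh /cosh; apply: is_derive_eq (is_deriveM_cst 2^-1
  (is_deriveD_fun (is_derive_expR x) (is_derive_expRN x))) _.
by [].
Qed.

Lemma sinhD x y : sinh (x + y) = sinh x * cosh y + cosh x * sinh y.
Proof. by rewrite /sinh /cosh opprD !expRD; field. Qed.

Lemma coshD x y : cosh (x + y) = cosh x * cosh y + sinh x * sinh y.
Proof. by rewrite /sinh /cosh opprD !expRD; field. Qed.

Lemma sinhN x : sinh (- x) = - sinh x.
Proof. by rewrite /sinh opprK; field. Qed.

Lemma coshN x : cosh (- x) = cosh x.
Proof. by rewrite /cosh opprK addrC. Qed.

Lemma sinh0 : sinh 0 = 0 :> R.
Proof. by rewrite /sinh oppr0 subrr mul0r. Qed.

Lemma cosh0 : cosh 0 = 1 :> R.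
Proof. by rewrite /cosh oppr0 expR0; field. Qed.

(* The derivative of [S_ t] at [0]. *)
Definition freq t : R := if t == 0 then 1 else Num.sqrt `|t|.

Lemma freq_neq0 t : freq t != 0.
Proof.
rewrite /freq; case: (eqVneq t 0) => [_|t0]; first exact: oner_neq0.
by rewrite sqrtr_eq0 -ltNge normr_gt0.
Qed.

(** The sign of [t]; with it the derivation and addition rules take one form in the circular, affine
    and hyperbolic cases. *)
Definition curv t : R := t / freq t ^+ 2.

Variant sc_spec : (R -> R) -> (R -> R) -> R -> R -> Type :=
| SCneg k : sc_spec (fun x => sin (k * x)) (fun x => cos (k * x)) k (- 1)
| SCzero : sc_spec id (fun=> 1) 1 0
| SCpos k : sc_spec (fun x => sinh (k * x)) (fun x => cosh (k * x)) k 1.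

Lemma scP t : sc_spec (S_ t) (C_ t) (freq t) (curv t).
Proof.
have k0 := freq_neq0 t.
have [t0|t0|t0] := ltgtP t 0.
- have kE : freq t = Num.sqrt (- t) by rewrite /freq lt_eqF// ltr0_norm.
  have tE : t = - freq t ^+ 2 by rewrite kE sqr_sqrtr ?opprK// oppr_ge0 ltW.
  have -> : S_ t = (fun x => sin (freq t * x)).
    by apply/funext => x; rewrite /S_ t0 kE.
  have -> : C_ t = (fun x => cos (freq t * x)).
    by apply/funext => x; rewrite /C_ t0 kE.
  have -> : curv t = - 1.
    by rewrite /curv {1}tE mulNr divff// expf_neq0.
  exact: SCneg.
- have kE : freq t = Num.sqrt t by rewrite /freq gt_eqF// gtr0_norm.
  have tE : t = freq t ^+ 2 by rewrite kE sqr_sqrtr// ltW.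
  have -> : S_ t = (fun x => sinh (freq t * x)).
    by apply/funext => x; rewrite /S_ ltNge (ltW t0)/= gt_eqF// kE.
  have -> : C_ t = (fun x => cosh (freq t * x)).
    by apply/funext => x; rewrite /C_ ltNge (ltW t0)/= gt_eqF// kE.
  have -> : curv t = 1 by rewrite /curv {1}tE divff// expf_neq0.
  exact: SCpos.
- have -> : S_ t = id by apply/funext => x; rewrite /S_ t0 ltxx eqxx.
  have -> : C_ t = (fun=> 1) by apply/funext => x; rewrite /C_ t0 ltxx eqxx.
  have -> : freq t = 1 by rewrite /freq t0 eqxx.
  have -> : curv t = 0 by rewrite /curv t0 mul0r.
  exact: SCzero.
Qed.

Lemma curvE t : t = curv t * freq t ^+ 2.
Proof. by rewrite /curv divfK// expf_neq0// freq_neq0. Qed.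

Let is_derive_mul (k x : R) : is_derive x 1 (fun y => k * y) k.
Proof. by apply: is_derive_eq (is_derive_cstM k (is_derive_id x 1)) _; rewrite mulr1. Qed.

Lemma is_derive_S t x : is_derive x 1 (S_ t) (freq t * C_ t x).
Proof.
case: scP => [k||k].
- by apply: is_derive_eq (is_derive_comp_fun (is_derive_sin _) (is_derive_mul k x)) _; rewrite mulrC.
- by rewrite mulr1; exact: is_derive_id.
- by apply: is_derive_eq (is_derive_comp_fun (is_derive_sinh _) (is_derive_mul k x)) _; rewrite mulrC.
Qed.

Lemma is_derive_C t x : is_derive x 1 (C_ t) (curv t * freq t * S_ t x).
Proof.
case: scP => [k||k].
- by apply: is_derive_eq (is_derive_comp_fun (is_derive_cos _) (is_derive_mul k x)) _; ring.
- by rewrite !mul0r; exact: is_derive_cst.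
- by apply: is_derive_eq (is_derive_comp_fun (is_derive_cosh _) (is_derive_mul k x)) _; ring.
Qed.

Lemma S_D t x y : S_ t (x + y) = S_ t x * C_ t y + C_ t x * S_ t y.
Proof.
case: scP => [k||k].
- by rewrite mulrDr sinD.
- by rewrite mulr1 mul1r.
- by rewrite mulrDr sinhD.
Qed.

Lemma C_D t x y : C_ t (x + y) = C_ t x * C_ t y + curv t * (S_ t x * S_ t y).
Proof.
case: scP => [k||k].
- by rewrite mulrDr cosD mulN1r.
- by rewrite mulr1 mul0r addr0.
- by rewrite mulrDr coshD mul1r.
Qed.

Lemma S_N t x : S_ t (- x) = - S_ t x.
Proof. by case: scP => [k||k]; rewrite ?mulrN ?sinN ?sinhN. Qed.

Lemma C_N t x : C_ t (- x) = C_ t x.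
Proof. by case: scP => [k||k]; rewrite ?mulrN ?cosN ?coshN. Qed.

Lemma S_0 t : S_ t 0 = 0.
Proof. by case: scP => [k||k]; rewrite ?mulr0 ?sin0 ?sinh0. Qed.

Lemma C_0 t : C_ t 0 = 1.
Proof. by case: scP => [k||k]; rewrite ?mulr0 ?cos0 ?cosh0. Qed.

(** The addition formula for [C_] at x + (- x). *)
Lemma C2BS2 t x : C_ t x ^+ 2 - curv t * S_ t x ^+ 2 = 1.
Proof.
by rewrite -[RHS](C_0 t) -[in RHS](subrr x) C_D C_N S_N; ring.
Qed.

End trigonometric_pairs.

(** * First-order systems with trigonometric solutions *)

Section first_order_system.
Context {R : realType}.
Variables (I : set R) (w f f1 g g1 : R -> R) (alpha e : R).
Hypotheses (I_nonempty : I !=set0) (I_interval : is_interval I).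
Hypothesis df : forall x, I x -> is_derive x 1 f (w x * f1 x).
Hypothesis dg : forall x, I x -> is_derive x 1 g (w x * g1 x).
Hypothesis df1 : forall x, I x -> is_derive x 1 f1 (alpha * w x * f x).
Hypothesis dg1 : forall x, I x -> is_derive x 1 g1 (alpha * w x * g x).
Hypothesis e_neq0 : e != 0.
Hypothesis det : forall x, I x -> f1 x * g x - f x * g1 x = e.

(** For any two solutions the expression v1 y - v y1 is constant, so the coefficients given by
    Cramer's rule at [z] are valid at every point. *)
Lemma first_order_solution (u u1 : R -> R) :
  (forall x, I x -> is_derive x 1 u (w x * u1 x)) ->
  (forall x, I x -> is_derive x 1 u1 (alpha * w x * u x)) ->
  exists a b, forall x, I x ->
    u x = a * f x + b * g x /\ u1 x = a * f1 x + b * g1 x.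
Proof.
move=> du du1; have [z Iz] := I_nonempty.
exists ((u1 z * g z - u z * g1 z) / e), ((f1 z * u z - f z * u1 z) / e) => x Ix.
have cst (v v1 : R -> R) (y y1 : R -> R) :
    (forall x, I x -> is_derive x 1 v (w x * v1 x)) ->
    (forall x, I x -> is_derive x 1 v1 (alpha * w x * v x)) ->
    (forall x, I x -> is_derive x 1 y (w x * y1 x)) ->
    (forall x, I x -> is_derive x 1 y1 (alpha * w x * y x)) ->
    v1 z * y z - v z * y1 z = v1 x * y x - v x * y1 x.
  move=> dv dv1 dy dy1.
  apply: (derive0_cst I_interval (f := fun t => v1 t * y t - v t * y1 t)) => // t It.
  apply: is_derive_eq (is_deriveB_fun (is_deriveM_fun (dv1 _ It) (dy _ It))
    (is_deriveM_fun (dv _ It) (dy1 _ It))) _.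
  by ring.
rewrite (cst u u1 g g1)// (cst f f1 u u1)// -(det Ix).
have := e_neq0; rewrite -(det Ix) => e0.
by split; field.
Qed.

Lemma first_order_trigonometric (phi : R -> R) : antiderivative I w phi ->
  equivalent_pairs I f g (S_ alpha \o phi) (C_ alpha \o phi).
Proof.
move=> dphi; have k0 := freq_neq0 alpha; have aE := curvE alpha.
set k := freq alpha in k0 aE; set s := curv alpha in aE.
have ds x : I x -> is_derive x 1 (S_ alpha \o phi) (w x * (k * C_ alpha (phi x))).
  move=> Ix; apply: is_derive_eq (is_derive_comp_fun (is_derive_S _ _) (dphi _ Ix)) _.
  by rewrite mulrC.
have dc x : I x -> is_derive x 1 (C_ alpha \o phi) (w x * (s * k * S_ alpha (phi x))).
  move=> Ix; apply: is_derive_eq (is_derive_comp_fun (is_derive_C _ _) (dphi _ Ix)) _.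
  by rewrite mulrC.
have ds1 x : I x ->
    is_derive x 1 (fun x => k * C_ alpha (phi x)) (alpha * w x * S_ alpha (phi x)).
  by move=> Ix; apply: is_derive_eq (is_derive_cstM k (dc x Ix)) _; rewrite aE; ring.
have dc1 x : I x ->
    is_derive x 1 (fun x => s * k * S_ alpha (phi x)) (alpha * w x * C_ alpha (phi x)).
  by move=> Ix; apply: is_derive_eq (is_derive_cstM (s * k) (ds x Ix)) _; rewrite aE; ring.
have [a [b sE]] := first_order_solution ds ds1.
have [c [d cE]] := first_order_solution dc dc1.
exists a, b, c, d; split; last by move=> x Ix; have [-> _] := sE _ Ix; have [-> _] := cE _ Ix.
have [x Ix] := I_nonempty; apply: contra_neq k0 => abcd.
have [s0 s1] := sE x Ix; have [c0 c1] := cE x Ix; rewrite /= in s0 c0.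
(* The frequency is the determinant of the trigonometric solution, hence (a d - b c) times that of
   (f, g); it would be 0 if a d = b c. *)
have := C2BS2 alpha (phi x) => /(congr1 (fun z => k * z)); rewrite mulr1 => <-.
have -> : k * (C_ alpha (phi x) ^+ 2 - s * S_ alpha (phi x) ^+ 2) =
  k * C_ alpha (phi x) * C_ alpha (phi x) - S_ alpha (phi x) * (s * k * S_ alpha (phi x)).
  by ring.
rewrite s1 c1 s0 c0.
have -> : forall a b c d f g f1 g1 : R, (a * f1 + b * g1) * (c * f + d * g) -
    (a * f + b * g) * (c * f1 + d * g1) = (a * d - b * c) * (f1 * g - f * g1).
  by move=> *; ring.
by rewrite abcd subrr mul0r.
Qed.

End first_order_system.

(** * Means of equivalent and of trigonometric pairs *)

Section mean_equalities.
Context {R : realType}.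
Variable I : set R.
Hypothesis I_interval : is_interval I.
Local Notation mu := (half_dirac : probability (measurableTypeR R) R).
Implicit Types f g F G phi w : R -> R.

Lemma equivalent_equal_mean f g F G : class_C 2 I f g -> class_C 2 I F G ->
  equivalent_pairs I f g F G -> equal_on_square I (mean I f g mu) (mean I F G mu).
Proof.
move=> fgC FGC [a [b [c [d [_ E]]]]] x y Ix Iy; symmetry.
have [Iz zE] := mean_spec I_interval fgC Ix Iy.
apply: (mean_unique I_interval FGC) => //.
have [-> ->] := E x Ix; have [-> ->] := E y Iy; have [-> ->] := E _ Iz.
move: zE; set m := mean _ _ _ _ _ _ => zE.
apply/eqP; rewrite -subr_eq0; apply/eqP.
have -> : (a * f m + b * g m) * (c * f x + d * g x + (c * f y + d * g y)) -
    (c * f m + d * g m) * (a * f x + b * g x + (a * f y + b * g y)) =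
    (a * d - b * c) * (f m * (g x + g y) - g m * (f x + f y)) by ring.
by rewrite zE subrr mulr0.
Qed.

Lemma trigonometric_mean f g phi w (alpha : R) : class_C 2 I f g ->
  antiderivative I w phi -> (forall x, I x -> w x != 0) ->
  equivalent_pairs I f g (S_ alpha \o phi) (C_ alpha \o phi) ->
  equal_on_square I (mean I f g mu) (quasiarithmetic_mean I phi).
Proof.
move=> fgC dphi w0 [a [b [c [d [abcd E]]]]] x y Ix Iy.
have phi_c : {in I, continuous phi}.
  by move=> t; rewrite inE => It; exact: is_derive_continuous (dphi _ It).
have [z Iz zE] : exists2 z, I z & phi z = (phi x + phi y) / 2.
  apply: (IVT_on I_interval phi_c Ix Iy); rewrite ge_min le_max.
  have [xy|/ltW yx] := leP (phi x) (phi y); apply/andP; split; apply/orP.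
  - by left; lra.
  - by right; lra.
  - by right; lra.
  - by left; lra.
have -> : quasiarithmetic_mean I phi x y = z.
  rewrite /quasiarithmetic_mean -zE (pinvKV (fun=> point)) ?inE//.
  exact: derive_neq0_inj dphi w0.
apply: (mean_unique I_interval fgC) => //.
pose h := (phi x - phi y) / 2.
have [Sx Cx] := E x Ix; have [Sy Cy] := E y Iy; have [Sz Cz] := E z Iz.
have xE : phi x = phi z + h by rewrite zE /h; field.
have yE : phi y = phi z + - h by rewrite zE /h; field.
rewrite /= in Sx Cx Sy Cy Sz Cz.
(* With z the midpoint in [phi] and h the half-difference, S(z + h) + S(z - h) = 2 C(h) S(z), and
   likewise for C. Inverting the matrix carries this to f and g, both with the factor 2 C(h). *)
have SE : a * (f x + f y - 2 * C_ alpha h * f z) +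
    b * (g x + g y - 2 * C_ alpha h * g z) = 0.
  have -> : a * (f x + f y - 2 * C_ alpha h * f z) +
      b * (g x + g y - 2 * C_ alpha h * g z) =
      (a * f x + b * g x) + (a * f y + b * g y) - 2 * C_ alpha h * (a * f z + b * g z).
    by ring.
  by rewrite -Sx -Sy -Sz xE yE !S_D S_N C_N; ring.
have CE : c * (f x + f y - 2 * C_ alpha h * f z) +
    d * (g x + g y - 2 * C_ alpha h * g z) = 0.
  have -> : c * (f x + f y - 2 * C_ alpha h * f z) +
      d * (g x + g y - 2 * C_ alpha h * g z) =
      (c * f x + d * g x) + (c * f y + d * g y) - 2 * C_ alpha h * (c * f z + d * g z).
    by ring.
  by rewrite -Cx -Cy -Cz xE yE !C_D S_N C_N; ring.
move: SE CE; set p := _ - _; set q := _ - _ => SE CE.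
have abcd' : a * d - b * c != 0 by rewrite subr_eq0.
have p0 : p = 0.
  apply: (mulfI abcd'); rewrite mulr0.
  have -> : (a * d - b * c) * p = d * (a * p + b * q) - b * (c * p + d * q) by ring.
  by rewrite SE CE; ring.
have q0 : q = 0.
  apply: (mulfI abcd'); rewrite mulr0.
  have -> : (a * d - b * c) * q = a * (c * p + d * q) - c * (a * p + b * q) by ring.
  by rewrite SE CE; ring.
have -> : f x + f y = 2 * C_ alpha h * f z by apply/eqP; rewrite -subr_eq0 -/p p0.
have -> : g x + g y = 2 * C_ alpha h * g z by apply/eqP; rewrite -subr_eq0 -/q q0.
by ring.
Qed.

End mean_equalities.

(** * Quadratic relations between f and g *)

Section quadratic_relation.
Context {R : realType}.
Variables (I : set R) (f g : R -> R).
Hypotheses (I_nonempty : I !=set0) (I_open : open I) (I_interval : is_interval I).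
Hypothesis fgC : class_C 2 I f g.
Local Notation smooth := continuously_differentiable.
Local Notation w := (wronskian 1 0 f g).

(* In the variable [phi] with [phi' = w], the equation [Psi = alpha * w ^+ 2]
   reads [f'' = alpha * f], so that [f' ^+ 2 - alpha * f ^+ 2] and its polar forms
   are first integrals; they are the coefficients of the quadratic relation,
   because the Wronskian is [1] in this variable. *)
Lemma quadratic_of_Psi (alpha : R) :
  (forall x, I x -> Psi f g x = alpha * w x ^+ 2) ->
  exists a b c : R, forall x, I x ->
    a * f x ^+ 2 + b * (f x * g x) + c * g x ^+ 2 = 1.
Proof.
move=> QE; have w0 := wronskian_neq0 fgC.
have d0 (u : R -> R) x : smooth 2 I u -> I x ->
    is_derive x 1 u (w x * (derive1n 1 u x / w x)).
  move=> su Ix; apply: is_derive_eq (smooth_is_derive su Ix) _.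
  by rewrite mulrC divfK// w0.
have d1 (u : R -> R) x : smooth 2 I u -> I x ->
    derive1n 2 u x = Phi f g x * derive1n 1 u x + Psi f g x * u x ->
    is_derive x 1 (fun x => derive1n 1 u x / w x) (alpha * w x * u x).
  move=> su Ix uE; have wx0 := w0 x Ix; 
  have ju : is_derive x 1 (derive1n 1 u) (derive1n 2 u x) by exact: (smooth_jet su).
  apply: is_derive_eq (is_derive_div wx0 ju (is_derive_wronskian fgC Ix)) _.
  rewrite uE QE//; move: wx0; move: (w x) (derive1n 1 u x) (Phi f g x) => *; field.
  by [].
have [sf sg] := (class_C_smooth1 fgC, class_C_smooth2 fgC).
have df x Ix := d0 f x sf Ix; have dg x Ix := d0 g x sg Ix.
have df1 x Ix := d1 f x sf Ix (pair_ode1 fgC Ix).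
have dg1 x Ix := d1 g x sg Ix (pair_ode2 fgC Ix).
pose f1 x := derive1n 1 f x / w x; pose g1 x := derive1n 1 g x / w x.
have [z Iz] := I_nonempty.
have cst (u u1 v v1 : R -> R) :
    (forall x, I x -> is_derive x 1 u (w x * u1 x)) ->
    (forall x, I x -> is_derive x 1 u1 (alpha * w x * u x)) ->
    (forall x, I x -> is_derive x 1 v (w x * v1 x)) ->
    (forall x, I x -> is_derive x 1 v1 (alpha * w x * v x)) ->
    forall x, I x -> u1 x * v1 x - alpha * (u x * v x) = u1 z * v1 z - alpha * (u z * v z).
  move=> du du1 dv dv1 x Ix.
  apply: (derive0_cst I_interval (f := fun t => u1 t * v1 t - alpha * (u t * v t))) => //.
  move=> t It; apply: is_derive_eq (is_deriveB_fun (is_deriveM_fun (du1 _ It) (dv1 _ It))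
    (is_derive_cstM alpha (is_deriveM_fun (du _ It) (dv _ It)))) _.
  by ring.
exists (g1 z * g1 z - alpha * (g z * g z)), (- 2 * (f1 z * g1 z - alpha * (f z * g z))),
  (f1 z * f1 z - alpha * (f z * f z)) => x Ix.
rewrite -(cst g g1 g g1 dg dg1 dg dg1 x)// -(cst f f1 f f1 df df1 df df1 x)//.
rewrite -(cst f f1 g g1 df df1 dg dg1 x)//.
have : f1 x * g x - f x * g1 x = 1.
  rewrite -(divff (w0 x Ix)) /f1 /g1; move: (w x)^-1 => r.
  by rewrite /wronskian !derive1n0; move: (derive1n 1 f x) (derive1n 1 g x) => *; ring.
(* The terms in [alpha] cancel, and the quadratic form equals (f1 g - f g1)^2. *)
move=> e; rewrite -[RHS](expr1n _ 2) -[in RHS]e; ring.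
Qed.

Section from_relation.
Variables a b c : R.
Hypothesis rel : forall x, I x -> a * f x ^+ 2 + b * (f x * g x) + c * g x ^+ 2 = 1.

(** Up to the factor w, (f, g) moves along the Hamiltonian field of half the quadratic form: [f1]
    and [g1] are half its partial derivatives in g and, negated, in f. The matrix of this field
    squares to [alpha] times the identity. *)
Let alpha := b ^+ 2 / 4 - a * c.
Let f1 x := b / 2 * f x + c * g x.
Let g1 x := - (a * f x + b / 2 * g x).

(** The relation Q = 1 and its derivative X = 0 determine f' and g' in terms of w: f' - w f1 = f X /
    2 - f' (Q - 1), and similarly for g. *)
Lemma relation_derive x : I x ->
  derive1n 1 f x = w x * f1 x /\ derive1n 1 g x = w x * g1 x.
Proof.
move=> Ix.
have df := is_derive_pair1 fgC Ix; have dg := is_derive_pair2 fgC Ix.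
have d1 := is_deriveD_fun (is_deriveD_fun
  (is_derive_cstM a (is_deriveX_fun 2 df))
  (is_derive_cstM b (is_deriveM_fun df dg)))
  (is_derive_cstM c (is_deriveX_fun 2 dg)).
have d0 := eq_on_is_derive I_open Ix (fun y Iy => esym (rel Iy)) (is_derive_cst _ _ _).
have := is_derive_unique d1 d0; rewrite /= expr1 => E.
have {}E : 2 * a * f x * derive1 f x + b * (derive1 f x * g x + f x * derive1 g x) +
    2 * c * g x * derive1 g x = 0 by rewrite -[RHS]E; ring.
have relx := rel Ix.
rewrite /wronskian /f1 /g1 !derive1n0 !derive1n1.
move: E relx; move: (derive1 f x) (derive1 g x) (f x) (g x) => f' g' u v.
set X := (X in X = 0); set Q := (X in X = 1) => E relx; split.
  apply: subr0_eq; rewrite (_ : _ - _ = u / 2 * X - f' * (Q - 1)).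
    by rewrite E relx subrr !mulr0 subr0.
  by rewrite /X /Q; field.
apply: subr0_eq; rewrite (_ : _ - _ = v / 2 * X - g' * (Q - 1)).
  by rewrite E relx subrr !mulr0 subr0.
by rewrite /X /Q; field.
Qed.

(** The factor [gamma] lets a single [phi] serve two pairs with proportional Wronskians; rescaling
    the variable by [gamma] multiplies [alpha] by its square. *)
Lemma trigonometric_of_quadratic (v phi : R -> R) (gamma : R) :
  (forall x, I x -> w x = gamma * v x) -> antiderivative I v phi ->
  equivalent_pairs I f g (S_ (gamma ^+ 2 * alpha) \o phi) (C_ (gamma ^+ 2 * alpha) \o phi).
Proof.
move=> wE dphi.
have df x : I x -> is_derive x 1 f (w x * f1 x).
  by move=> Ix; have [<- _] := relation_derive Ix; exact: (is_derive_pair1 fgC).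
have dg x : I x -> is_derive x 1 g (w x * g1 x).
  by move=> Ix; have [_ <-] := relation_derive Ix; exact: (is_derive_pair2 fgC).
have gamma0 : gamma != 0.
  have [x Ix] := I_nonempty; have := wronskian_neq0 fgC Ix.
  by apply: contra_neq => g0; rewrite wE// g0 mul0r.
have df' x : I x -> is_derive x 1 f (v x * (gamma * f1 x)).
  by move=> Ix; apply: is_derive_eq (df x Ix) _; rewrite wE//; ring.
have dg' x : I x -> is_derive x 1 g (v x * (gamma * g1 x)).
  by move=> Ix; apply: is_derive_eq (dg x Ix) _; rewrite wE//; ring.
have df1 x : I x ->
    is_derive x 1 (fun x => gamma * f1 x) (gamma ^+ 2 * alpha * v x * f x).
  move=> Ix; apply: is_derive_eq (is_derive_cstM gamma (is_deriveD_fun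
    (is_derive_cstM (b / 2) (df x Ix)) (is_derive_cstM c (dg x Ix)))) _.
  by rewrite wE// /f1 /g1 /alpha; field.
have dg1 x : I x ->
    is_derive x 1 (fun x => gamma * g1 x) (gamma ^+ 2 * alpha * v x * g x).
  move=> Ix; apply: is_derive_eq (is_derive_cstM gamma (is_deriveN_fun (is_deriveD_fun
    (is_derive_cstM a (df x Ix)) (is_derive_cstM (b / 2) (dg x Ix))))) _.
  by rewrite wE// /f1 /g1 /alpha; field.
have det x : I x -> gamma * f1 x * g x - f x * (gamma * g1 x) = gamma.
  by move=> Ix; rewrite -[RHS]mulr1 -(rel Ix) /f1 /g1; field.
exact: (first_order_trigonometric I_nonempty I_interval df' dg' df1 dg1 gamma0 det dphi).
Qed.

End from_relation.

End quadratic_relation.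

(** * Angles that are only strictly monotone *)

Section monotone_angle.
Context {R : realType}.
Variable I : set R.
Hypotheses (I_open : open I) (I_interval : is_interval I).

Lemma monotonic_right_limit (phi : R -> R) (x : R) : strict_monotonic I phi -> I x ->
  exists l : R, phi t @[t --> x^'+] --> l.
Proof.
move=> phim Ix; have [b Ib xb] := open_gtr I_open Ix.
have xbI t : t \in Interval (BRight x) (BRight b) -> I t /\ x < t.
  rewrite in_itv/= => /andP[xt tb]; split=> //.
  by apply: (I_interval Ix Ib); rewrite (ltW xt).
have xb' : (BRight x < BRight b)%O by rewrite bnd_simp.
case: phim => phim; eexists.
- apply: (nondecreasing_at_right_cvgr xb').
    move=> s t /xbI[Is _] /xbI[It _]; rewrite le_eqVlt => /predU1P[->//|st].
    by apply/ltW/phim => //; rewrite inE.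
  exists (phi x) => _ [t /xbI[It xt] <-].
  by apply/ltW/phim => //; rewrite inE.
- apply: (nonincreasing_at_right_cvgr xb').
    move=> s t /xbI[Is _] /xbI[It _]; rewrite le_eqVlt => /predU1P[->//|st].
    by apply/ltW/phim => //; rewrite inE.
  exists (phi x) => _ [t /xbI[It xt] <-].
  by apply/ltW/phim => //; rewrite inE.
Qed.

(* The function [phi] may jump by periods of [S_ alpha] and [C_ alpha], so it is
   compared with its right limit [l] rather than with its value at [x]. *)
Lemma angle_slope (alpha : R) (phi u v : R -> R) (x l du dv : R) : I x ->
  phi t @[t --> x^'+] --> l ->
  (forall t, I t -> u t = S_ alpha (phi t) /\ v t = C_ alpha (phi t)) ->
  is_derive x 1 u du -> is_derive x 1 v dv ->
  exists h : R -> R,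
    h (phi t - l) @[t --> x^'+] --> freq alpha /\
    h (phi t - l) * ((phi t - l) / (t - x)) @[t --> x^'+] --> du * v x - dv * u x.
Proof.
move=> Ix phil E dux dvx.
have xR : \forall t \near x^'+, I t by apply: cvg_within; exact: open_near.
(* As u and v are continuous at [x], their values there are the sine and cosine of [l], even if
   [phi x] differs from [l]. *)
have lim_comp (k K : R -> R) : (forall t, I t -> k t = K (phi t)) ->
    {for x, continuous k} -> {for l, continuous K} -> k x = K l.
  move=> kE kc Kc; apply: (@cvg_unique _ _ (k @ x^'+)).
  - exact: Rhausdorff.
  - exact: cvg_at_right_filter.
  - apply: (@cvg_trans _ ((K \o phi) @ x^'+)); last exact: cvg_comp phil Kc.
    by apply: near_eq_cvg; near=> t; rewrite /= kE//; near: t.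
have ux : u x = S_ alpha l.
  apply: lim_comp => [t It||]; first by have [] := E t It.
    exact: is_derive_continuous dux.
  exact: is_derive_continuous (is_derive_S _ _).
have vx : v x = C_ alpha l.
  apply: lim_comp => [t It||]; first by have [] := E t It.
    exact: is_derive_continuous dvx.
  exact: is_derive_continuous (is_derive_C _ _).
(* The slope function satisfies S(e) = h(e) e also at e = 0, so no division by [phi t - l] takes
   place. *)
have [h [hE hc h0]] := (is_derive1_caratheodory _ _ _).1 (is_derive_S alpha 0).
rewrite C_0 mulr1 in h0.
(* By the subtraction formula, u(t) v(x) - v(t) u(x) = S(phi t - l); its slope function at [x]
   yields the second limit. *)
have [q [qE qc qx]] := (is_derive1_caratheodory _ _ _).1
  (is_deriveB_fun (is_deriveM_cst (v x) dux) (is_deriveM_cst (u x) dvx)).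
have eps0 : phi t - l @[t --> x^'+] --> (0 : R).
  by rewrite -[X in _ --> X](subrr l); apply: cvgB => //; exact: cvg_cst.
exists h; split.
  by rewrite -h0; exact: (cvg_comp _ _ eps0 hc).
rewrite -qx; apply: (@cvg_trans _ (q @ x^'+)); last exact: cvg_at_right_filter.
apply: near_eq_cvg; near=> t.
have It : I t by near: t.
have xt : t - x != 0 by rewrite subr_eq0 gt_eqF//; near: t; exact: nbhs_right_gt.
apply: (mulIf xt); rewrite -qE mulrA divfK//.
have := hE (phi t - l); rewrite S_0 !subr0 => <-.
have [ut vt] := E t It.
by rewrite S_D S_N C_N -ux -vx -ut -vt; ring.
Unshelve. all: by end_near. Qed.

(** The product of [h], [k] and the slope of [phi] has two limits according to which of [h], [k] is
    grouped with the slope; the slope of [phi] is thus eliminated. *)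
Lemma angle_slopes_proportional (alpha beta : R) (phi u v U V : R -> R)
    (x du dv dU dV : R) : strict_monotonic I phi -> I x ->
  (forall t, I t -> u t = S_ alpha (phi t) /\ v t = C_ alpha (phi t)) ->
  (forall t, I t -> U t = S_ beta (phi t) /\ V t = C_ beta (phi t)) ->
  is_derive x 1 u du -> is_derive x 1 v dv ->
  is_derive x 1 U dU -> is_derive x 1 V dV ->
  freq beta * (du * v x - dv * u x) = freq alpha * (dU * V x - dV * U x).
Proof.
move=> phim Ix E1 E2 dux dvx dUx dVx.
have [l phil] := monotonic_right_limit phim Ix.
have [h [h0 hs]] := angle_slope Ix phil E1 dux dvx.
have [k [k0 ks]] := angle_slope Ix phil E2 dUx dVx.
apply: (@cvg_unique R _
  ((fun t => k (phi t - l) * (h (phi t - l) * ((phi t - l) / (t - x)))) @ x^'+)).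
- exact: Rhausdorff.
- exact: cvgM.
- rewrite (_ : (fun t => k _ * _) =
      (fun t => h (phi t - l) * (k (phi t - l) * ((phi t - l) / (t - x))))).
    exact: cvgM.
  by apply/funext => t; ring.
Qed.

End monotone_angle.

(** * Equivalent descriptions of non-equivalent pairs with equal means *)

Section characterizations.
Context {R : realType}.
Variables (I : set R) (f g F G : R -> R).
Hypotheses (I_nonempty : I !=set0) (I_open : open I) (I_interval : is_interval I).
Hypotheses (fgC : class_C 2 I f g) (FGC : class_C 2 I F G).
Local Notation mu := (half_dirac : probability (measurableTypeR R) R).
Local Notation w := (wronskian 1 0 f g).
Local Notation W := (wronskian 1 0 F G).

(** The hub of the argument: the differential, polynomial and trigonometric descriptions all lead to
    it, and the quasiarithmetic mean is derived from it. *)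
Definition quadratic_relations : Prop :=
  exists a b c A B C gamma : R, forall x, I x ->
    [/\ a * f x ^+ 2 + b * (f x * g x) + c * g x ^+ 2 = 1,
        A * F x ^+ 2 + B * (F x * G x) + C * G x ^+ 2 = 1
      & W x = gamma * w x].

Lemma wronskian_antiderivative : exists phi, antiderivative I w phi.
Proof.
apply: antiderivative_exists => //.
have le11 : (1 + 1 <= 2)%N by []. have le01 : (0 + 1 <= 2)%N by [].
exact: smooth_continuous (smooth_wronskian I_open fgC le11 le01).
Qed.

Lemma quadratic_of_ode :
  (forall x, I x -> Phi f g x = Phi F G x) ->
  (exists alpha beta : R, forall x, I x ->
    Psi f g x = alpha * w x ^+ 2 /\ Psi F G x = beta * w x ^+ 2) ->
  quadratic_relations.
Proof.
move=> PE [al [be QE]].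
have [|gamma gE] := proportional_wronskian I_nonempty I_interval fgC (k := 1) (y := W).
  move=> x Ix; rewrite mul1r PE//; exact: (is_derive_wronskian FGC Ix).
have [a [b [c E1]]] := quadratic_of_Psi I_nonempty I_interval fgC
  (fun x Ix => (QE x Ix).1).
have gamma0 : gamma != 0.
  have [x Ix] := I_nonempty; have := wronskian_neq0 FGC Ix.
  by apply: contra_neq => g0; rewrite gE// g0 mul0r.
(* [beta] refers to the Wronskian of (f, g); in terms of that of (F, G) it is divided by gamma^2. *)
have QE2 x : I x -> Psi F G x = be / gamma ^+ 2 * W x ^+ 2.
  by move=> Ix; rewrite (QE x Ix).2 gE// expr1; field.
have [A [B [C E2]]] := quadratic_of_Psi I_nonempty I_interval FGC QE2.
by exists a, b, c, A, B, C, gamma => x Ix; split; [exact: E1|exact: E2|rewrite gE].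
Qed.

Lemma quadratic_trigonometric (phi : R -> R) : quadratic_relations ->
  antiderivative I w phi -> exists alpha beta : R,
    equivalent_pairs I f g (S_ alpha \o phi) (C_ alpha \o phi) /\
    equivalent_pairs I F G (S_ beta \o phi) (C_ beta \o phi).
Proof.
move=> [a [b [c [A [B [C [gamma E]]]]]]] dphi.
(* The pair (f, g) is the instance gamma = 1, since [phi] is an antiderivative of its own
   Wronskian. *)
exists (1 ^+ 2 * (b ^+ 2 / 4 - a * c)), (gamma ^+ 2 * (B ^+ 2 / 4 - A * C)); split.
  apply: (trigonometric_of_quadratic I_nonempty I_open I_interval fgC _ _ dphi).
    by move=> x /E[].
  by move=> x _; rewrite mul1r.
apply: (trigonometric_of_quadratic I_nonempty I_open I_interval FGC _ _ dphi).
  by move=> x /E[].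
by move=> x /E[].
Qed.

Lemma quadratic_of_trigonometric (phi : R -> R) (alpha beta : R) :
  strict_monotonic I phi ->
  equivalent_pairs I f g (S_ alpha \o phi) (C_ alpha \o phi) ->
  equivalent_pairs I F G (S_ beta \o phi) (C_ beta \o phi) ->
  quadratic_relations.
Proof.
move=> phim [a [b [c [d [abcd E]]]]] [A [B [C [D [ABCD E']]]]].
have rel (u v : R -> R) (t p q r s : R) : (forall x, I x ->
    (S_ t \o phi) x = p * u x + q * v x /\ (C_ t \o phi) x = r * u x + s * v x) ->
    forall x, I x -> (r ^+ 2 - curv t * p ^+ 2) * u x ^+ 2 +
      (2 * (r * s - curv t * (p * q))) * (u x * v x) +
      (s ^+ 2 - curv t * q ^+ 2) * v x ^+ 2 = 1.
  move=> uv x Ix; have [/= sE cE] := uv x Ix.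
  by rewrite -[RHS](C2BS2 t (phi x)) sE cE; ring.
exists (c ^+ 2 - curv alpha * a ^+ 2), (2 * (c * d - curv alpha * (a * b))),
  (d ^+ 2 - curv alpha * b ^+ 2).
exists (C ^+ 2 - curv beta * A ^+ 2), (2 * (C * D - curv beta * (A * B))),
  (D ^+ 2 - curv beta * B ^+ 2).
(* The Wronskians of the trigonometric pairs are (a d - b c) w and (A D - B C) W, and their ratio is
   that of the frequencies. *)
exists ((freq beta * (a * d - b * c)) / (freq alpha * (A * D - B * C))) => x Ix.
split; [exact: rel E x Ix|exact: rel E' x Ix|].
have comb (u v : R -> R) (p q : R) : class_C 2 I u v -> is_derive x 1
    (fun t => p * u t + q * v t) (p * derive1 u x + q * derive1 v x).
  by move=> uvC; apply: is_deriveD_fun; apply: is_derive_cstM;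
    [exact: (is_derive_pair1 uvC)|exact: (is_derive_pair2 uvC)].
have := @angle_slopes_proportional _ _ I_open I_interval alpha beta phi
  (fun t => a * f t + b * g t) (fun t => c * f t + d * g t)
  (fun t => A * F t + B * G t) (fun t => C * F t + D * G t) x _ _ _ _ phim Ix
  (fun t It => let: conj p q := E t It in conj (esym p) (esym q))
  (fun t It => let: conj p q := E' t It in conj (esym p) (esym q))
  (comb f g a b fgC) (comb f g c d fgC) (comb F G A B FGC) (comb F G C D FGC).
have -> : forall f f1 g g1 a b c d : R, (a * f1 + b * g1) * (c * f + d * g) -
    (c * f1 + d * g1) * (a * f + b * g) = (a * d - b * c) * (f1 * g - f * g1).
  by move=> *; ring.
have -> : forall f f1 g g1 a b c d : R, (a * f1 + b * g1) * (c * f + d * g) -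
    (c * f1 + d * g1) * (a * f + b * g) = (a * d - b * c) * (f1 * g - f * g1).
  by move=> *; ring.
rewrite -[derive1 f x * g x - _]/(w x) -[derive1 F x * G x - _]/(W x) !mulrA => H.
have n0 : freq alpha * (A * D - B * C) != 0.
  by rewrite mulf_neq0 ?freq_neq0// subr_eq0.
by apply: (mulfI n0); rewrite -H; move: n0; set n := freq alpha * _ => n0; field.
Qed.

Lemma quadratic_means (phi : R -> R) : quadratic_relations -> antiderivative I w phi ->
  equal_on_square I (mean I f g mu) (quasiarithmetic_mean I phi) /\
  equal_on_square I (quasiarithmetic_mean I phi) (mean I F G mu).
Proof.
move=> Q dphi; have [al [be [E1 E2]]] := quadratic_trigonometric Q dphi.
have w0 := wronskian_neq0 fgC.
split; first exact: trigonometric_mean fgC dphi w0 E1.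
by move=> x y Ix Iy; symmetry; apply: (trigonometric_mean I_interval FGC dphi w0 E2).
Qed.

Definition polynomial_representation : Prop :=
  exists P Q : {poly R},
    [/\ (size P <= 3)%N /\ (size Q <= 3)%N,
        (forall x, I x -> 0 < P.[f x / g x]),
        (forall x, I x -> 0 < Q.[F x / G x]),
        (forall x, I x -> g x = 1 / Num.sqrt P.[f x / g x] /\
                          G x = 1 / Num.sqrt Q.[F x / G x])
      & exists (p q : R -> R) (gamma delta : R),
        [/\ antiderivative [set f x / g x | x in I] (fun y => 1 / P.[y]) p,
            antiderivative [set F x / G x | x in I] (fun y => 1 / Q.[y]) q
          & forall x, I x -> q (F x / G x) = gamma * p (f x / g x) + delta]].

(** Division of the quadratic relation by v^2. *)
Let quadratic_polynomial (u v : R -> R) (a b c : R) : class_C 2 I u v ->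
  (forall x, I x -> a * u x ^+ 2 + b * (u x * v x) + c * v x ^+ 2 = 1) ->
  exists2 P : {poly R}, (size P <= 3)%N &
    forall x, I x -> P.[u x / v x] = (v x)^-1 ^+ 2.
Proof.
move=> uvC E; exists (Poly [:: c; b; a]); first exact: size_Poly.
move=> x Ix; have v0 := class_C_neq0 uvC Ix.
rewrite horner_Poly /= -[RHS]mulr1 -(E x Ix).
by field.
Qed.

Let polynomial_sqrt (u v : R -> R) (P : {poly R}) x : class_C 2 I u v -> I x ->
  P.[u x / v x] = (v x)^-1 ^+ 2 ->
  0 < P.[u x / v x] /\ v x = 1 / Num.sqrt P.[u x / v x].
Proof.
move=> uvC Ix PE; have v0 := class_C_gt0 uvC Ix.
rewrite PE exprn_gt0 ?invr_gt0//; split=> //.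
by rewrite sqrtr_sqr gtr0_norm ?invr_gt0// div1r invrK.
Qed.

(** Substitution y = u / v: the derivative of [phi] is the Wronskian, that of the inverse is v^2
    over the Wronskian, and the product v^2 equals 1 / P. *)
Let antiderivative_pinv (u v phi : R -> R) (P : {poly R}) : class_C 2 I u v ->
  (forall x, I x -> P.[u x / v x] = (v x)^-1 ^+ 2) ->
  antiderivative I (wronskian 1 0 u v) phi ->
  antiderivative [set u x / v x | x in I] (fun y => 1 / P.[y])
    (phi \o pinv I (fun s => u s / v s)).
Proof.
move=> uvC PE dphi _ [x Ix <-].
have pK : pinv I (fun s => u s / v s) (u x / v x) = x.
  by rewrite (pinvKV (fun=> point) (ratio_inj I_interval uvC))// inE.
have dp : is_derive (u x / v x) 1 (pinv I (fun s => u s / v s))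
    (wronskian 1 0 u v x / v x ^+ 2)^-1.
  exact: (is_derive_pinv I_interval I_open (is_derive_ratio uvC) (derive_ratio_neq0 uvC) Ix).
have := dphi _ Ix; rewrite -{1}pK => dphi'.
apply: is_derive_eq (is_derive_comp_fun dphi' dp) _.
have v0 := class_C_neq0 uvC Ix; have w0 := wronskian_neq0 uvC Ix.
by rewrite PE//; move: w0; move: (wronskian _ _ _ _ _) => z z0; field; rewrite v0.
Qed.

Lemma polynomial_of_quadratic : quadratic_relations -> polynomial_representation.
Proof.
move=> [a [b [c [A [B [C [gamma E]]]]]]].
have [|P sP PE] := quadratic_polynomial fgC (a := a) (b := b) (c := c).
  by move=> x /E[].
have [|Q sQ QE] := quadratic_polynomial FGC (a := A) (b := B) (c := C).
  by move=> x /E[].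
have [phi dphi] := wronskian_antiderivative.
have dphi' : antiderivative I W (fun x => gamma * phi x).
  move=> x Ix; have [_ _ ->] := E x Ix; exact: is_derive_cstM (dphi x Ix).
exists P, Q; split=> //.
- by move=> x Ix; have [] := polynomial_sqrt fgC Ix (PE x Ix).
- by move=> x Ix; have [] := polynomial_sqrt FGC Ix (QE x Ix).
- move=> x Ix; have [_ {1}->] := polynomial_sqrt fgC Ix (PE x Ix).
  by have [_ {1}->] := polynomial_sqrt FGC Ix (QE x Ix).
(* Both antiderivatives come from the same [phi], whence [delta] = 0. *)
- exists (phi \o pinv I (fun s => f s / g s)),
    ((fun x => gamma * phi x) \o pinv I (fun s => F s / G s)), gamma, 0; split.
  + exact: antiderivative_pinv.
  + exact: antiderivative_pinv.
  + move=> x Ix; rewrite /= addr0.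
    rewrite (pinvKV (fun=> point) (ratio_inj I_interval fgC)) ?inE//.
    by rewrite (pinvKV (fun=> point) (ratio_inj I_interval FGC)) ?inE.
Qed.

Let relation_of_polynomial (u v : R -> R) (P : {poly R}) : class_C 2 I u v ->
  (size P <= 3)%N -> (forall x, I x -> P.[u x / v x] = (v x)^-1 ^+ 2) ->
  forall x, I x -> P`_2 * u x ^+ 2 + P`_1 * (u x * v x) + P`_0 * v x ^+ 2 = 1.
Proof.
move=> uvC sP PE x Ix; have v0 := class_C_neq0 uvC Ix.
have := PE x Ix; rewrite (horner_coef_wide _ sP) !big_ord_recr big_ord0/= => E.
have -> : 1 = (v x)^-1 ^+ 2 * v x ^+ 2 by rewrite -exprMn mulVf// expr1n.
by rewrite -E; field.
Qed.

Let polynomial_ratio (u v : R -> R) (P : {poly R}) x : I x ->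
  0 < P.[u x / v x] -> v x = 1 / Num.sqrt P.[u x / v x] ->
  P.[u x / v x] = (v x)^-1 ^+ 2.
Proof.
by move=> Ix P0 vE; rewrite [in RHS]vE div1r invrK sqr_sqrtr// ltW.
Qed.

Let is_derive_antiderivative_ratio (u v p : R -> R) (P : {poly R}) x :
  class_C 2 I u v -> (forall x, I x -> P.[u x / v x] = (v x)^-1 ^+ 2) -> I x ->
  antiderivative [set u x / v x | x in I] (fun y => 1 / P.[y]) p ->
  is_derive x 1 (fun t => p (u t / v t)) (wronskian 1 0 u v x).
Proof.
move=> uvC PE Ix dp; have v0 := class_C_neq0 uvC Ix.
apply: is_derive_eq (is_derive_comp_fun (dp _ _) (is_derive_ratio uvC Ix)) _.
  by exists x.
by rewrite PE//; move: (wronskian _ _ _ _ _) => z; field; rewrite v0.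
Qed.

(** Composed with the ratios, the antiderivatives of 1 / P and 1 / Q have the Wronskians as
    derivatives; differentiating the last identity gives W = gamma w. *)
Lemma quadratic_of_polynomial : polynomial_representation -> quadratic_relations.
Proof.
move=> [P [Q [[sP sQ] P0 Q0 E [p [q [gamma [delta [dp dq pq]]]]]]]].
have PE x : I x -> P.[f x / g x] = (g x)^-1 ^+ 2.
  by move=> Ix; apply: polynomial_ratio => //; [exact: P0|have [] := E x Ix].
have QE x : I x -> Q.[F x / G x] = (G x)^-1 ^+ 2.
  by move=> Ix; apply: polynomial_ratio => //; [exact: Q0|have [] := E x Ix].
exists P`_2, P`_1, P`_0, Q`_2, Q`_1, Q`_0, gamma => x Ix; split.
- exact: relation_of_polynomial.
- exact: relation_of_polynomial.
- have d1 := is_derive_antiderivative_ratio FGC QE Ix dq.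
  have d2 := is_deriveD_fun
    (is_derive_cstM gamma (is_derive_antiderivative_ratio fgC PE Ix dp))
    (is_derive_cst delta x 1).
  rewrite addr0 in d2.
  exact: is_derive_unique d1 (eq_on_is_derive I_open Ix (fun y Iy => esym (pq y Iy)) d2).
Qed.

End characterizations.

(** * Means equal near the diagonal *)

Section near_diagonal.
Context {R : realType}.
Variable I : set R.
Implicit Types (M N : R -> R -> R) (U : set (R * R)).
Local Notation mu := (half_dirac : probability (measurableTypeR R) R).

Let diag (x : R) : R * R := (x, x).

Lemma open_pair_preimage U (u v : R -> R) : open U -> continuous u -> continuous v ->
  open ((fun x => (u x, v x)) @^-1` U).
Proof.
move=> Uo uc vc; apply: open_comp => // x _.
exact: (@cvg_pair _ _ _ (nbhs x) (nbhs (u x)) (nbhs (v x)) _ _ _ u v (uc x) (vc x)).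
Qed.

Lemma open_square : open I -> open (I `*` I).
Proof.
move=> Io; rewrite openE => -[x y] [/= Ix Iy]; exists (I, I) => //=.
by split; exact: open_near.
Qed.

Lemma dense_diagonal_preimage U (D : set (R * R)) : open U -> D `<=` Defs.diagonal I ->
  Defs.diagonal I `<=` closure D -> D `<=` U -> I `<=` closure (diag @^-1` U).
Proof.
move=> Uo Ddiag Dcl DU x Ix B nB.
have [||[y z] [Dyz /= [By Bz]]] := Dcl (x, x) _ (B `*` B); first by split.
  by exists (B, B).
by have [_ /= yz] := Ddiag _ Dyz; exists y; split=> //; rewrite /= /diag {2}yz; exact: DU.
Qed.

Lemma mean_section_near_diagonal (f g F G : R -> R) U x k : open U -> U (x, x) ->
  (forall p, U p -> mean I f g mu p.1 p.2 = mean I F G mu p.1 p.2) ->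
  derive1n k (mean_section I f g mu x) 0 = derive1n k (mean_section I F G mu x) 0.
Proof.
move=> Uo Ux UE; apply: near_eq_derive1n_at.
pose j (u : R) := (2^-1 * u + x, - 2^-1 * u + x) : R * R.
have jo : open (j @^-1` U).
  apply: open_pair_preimage => // u.
    exact: is_derive_continuous (is_derive_affine _ _ _).
  exact: is_derive_continuous (is_derive_affine _ _ _).
have j0 : (j @^-1` U) 0 by rewrite /= /j !mulr0 !add0r.
near=> u; rewrite !mean_sectionE; apply: (UE (j u)).
by near: u; exact: open_near jo j0.
Unshelve. all: by end_near. Qed.

End near_diagonal.

(** Assertion (iv) is stated with the alternative of equivalent pairs: these share Phi and Psi and
    have equal means, while Psi / w^2 may be non-constant. In (ix), continuity of [phi] puts (phi x
    + phi y) / 2 in its range, so that [pinv] is a genuine inverse there. *)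
Theorem theorem15 (R : realType) (I : set R) (f g F G : R -> R)
  (I_nonempty : I !=set0) (I_open : open I) (I_interval : is_interval I)
  (fg_C6 : class_C 6 I f g) (FG_C6 : class_C 6 I F G) :
  let mu : probability (measurableTypeR R) R := half_dirac in
  [<->
    (* (i) *)
    equal_on_square I (mean I f g mu) (mean I F G mu);
    (* (ii) *)
    equal_near_diagonal I (mean I f g mu) (mean I F G mu);
    (* (iii) *)
    (forall x, I x ->
      [/\ derive1n 2 (mean_section I f g mu x) 0 = derive1n 2 (mean_section I F G mu x) 0,
          derive1n 4 (mean_section I f g mu x) 0 = derive1n 4 (mean_section I F G mu x) 0
        & derive1n 6 (mean_section I f g mu x) 0 = derive1n 6 (mean_section I F G mu x) 0]);
    (* (iv) *)
    (equivalent_pairs I f g F G \/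
     (forall x, I x -> Phi f g x = Phi F G x) /\
     exists alpha beta : R, forall x, I x ->
       Psi f g x = alpha * wronskian 1 0 f g x ^+ 2 /\
       Psi F G x = beta * wronskian 1 0 f g x ^+ 2);
    (* (v) *)
    (equivalent_pairs I f g F G \/
     exists a b c A B C gamma : R, forall x, I x ->
       [/\ a * f x ^+ 2 + b * (f x * g x) + c * g x ^+ 2 = 1,
           A * F x ^+ 2 + B * (F x * G x) + C * G x ^+ 2 = 1
         & wronskian 1 0 F G x = gamma * wronskian 1 0 f g x]);
    (* (vi) *)
    (equivalent_pairs I f g F G \/
     exists P Q : {poly R},
       [/\ (size P <= 3)%N /\ (size Q <= 3)%N,
           (forall x, I x -> 0 < P.[f x / g x]),
           (forall x, I x -> 0 < Q.[F x / G x]),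
           (forall x, I x -> g x = 1 / Num.sqrt P.[f x / g x] /\
                             G x = 1 / Num.sqrt Q.[F x / G x])
         & exists (p q : R -> R) (gamma delta : R),
           [/\ antiderivative [set f x / g x | x in I] (fun y => 1 / P.[y]) p,
               antiderivative [set F x / G x | x in I] (fun y => 1 / Q.[y]) q
             & forall x, I x -> q (F x / G x) = gamma * p (f x / g x) + delta]]);
    (* (vii) *)
    (equivalent_pairs I f g F G \/
     exists (phi : R -> R) (alpha beta : R),
       [/\ strict_monotonic I phi,
           equivalent_pairs I f g (S_ alpha \o phi) (C_ alpha \o phi)
         & equivalent_pairs I F G (S_ beta \o phi) (C_ beta \o phi)]);
    (* (viii) *)
    (equivalent_pairs I f g F G \/
     exists phi : R -> R,
       [/\ antiderivative I (wronskian 1 0 f g) phi,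
           equal_on_square I (mean I f g mu) (quasiarithmetic_mean I phi)
         & equal_on_square I (quasiarithmetic_mean I phi) (mean I F G mu)]);
    (* (ix) *)
    (equivalent_pairs I f g F G \/
     exists phi : R -> R,
       [/\ strict_monotonic I phi, {in I, continuous phi},
           equal_on_square I (mean I f g mu) (quasiarithmetic_mean I phi)
         & equal_on_square I (quasiarithmetic_mean I phi) (mean I F G mu)])].
Proof.
move=> mu.
have le26 : (2 <= 6)%N by [].
have fgC := class_C_leq le26 fg_C6; have FGC := class_C_leq le26 FG_C6.
have mean_of_alternative : equivalent_pairs I f g F G \/
    quadratic_relations I f g F G ->
    equal_on_square I (mean I f g mu) (mean I F G mu).
  case=> [eqv|quad]; first exact: (equivalent_equal_mean I_interval fgC FGC).
  have [phi dphi] := wronskian_antiderivative I_open I_interval fgC.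
  have [E1 E2] := quadratic_means I_nonempty I_open I_interval fgC FGC quad dphi.
  by move=> x y Ix Iy; rewrite E1// E2.
have derive_of_mean : equal_on_square I (mean I f g mu) (mean I F G mu) ->
    forall x k, I x ->
    derive1n k (mean_section I f g mu x) 0 = derive1n k (mean_section I F G mu x) 0.
  move=> E x k Ix.
  apply: (@mean_section_near_diagonal _ I f g F G (I `*` I)) => //.
    exact: open_square.
  by move=> [y z] [Iy Iz]; exact: E.
have quad_of_alternative := quadratic_of_ode I_nonempty I_interval fgC FGC.
tfae.
- move=> E; exists (I `*` I), (Defs.diagonal I); split=> //.
  + exact: open_square.
  + by split=> //; exact: subset_closure.
  + by move=> [x y] [/= Ix <-].
  + by move=> [x y] [Ix Iy]; exact: E.
- move=> [U [D [Uo UI [Ddiag Dcl] DU UE]]].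
  have Vd := dense_diagonal_preimage Uo Ddiag Dcl DU.
  have VI : (fun x => (x, x)) @^-1` U `<=` I by move=> x /UI[].
  have V_eq x k : U (x, x) ->
    derive1n k (mean_section I f g mu x) 0 = derive1n k (mean_section I F G mu x) 0.
    by move=> Ux; exact: mean_section_near_diagonal Uo Ux UE.
  have alt := alternative_of_mean_derivatives I_nonempty I_open I_interval fg_C6 FG_C6 VI Vd
    (fun x Ux => And3 (V_eq x 2%N Ux) (V_eq x 4%N Ux) (V_eq x 6%N Ux)).
  (* At a point x with (x, x) outside U no local equality of the means is given; the global one is
     used instead. *)
  move=> x Ix; have E := derive_of_mean (mean_of_alternative _).
  split; apply: E => //;
    by case: alt => [?|[PE QE]]; [left|right; exact: quad_of_alternative].
- exact: (alternative_of_mean_derivatives I_nonempty I_open I_interval fg_C6 FG_C6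
    (@subset_refl _ I) (@subset_closure _ I)).
- case=> [?|[PE QE]]; [by left|right].
  exact: quad_of_alternative.
- case=> [?|quad]; [by left|right].
  exact: (polynomial_of_quadratic I_open I_interval fgC FGC quad).
- case=> [?|poly]; [by left|right].
  have [phi dphi] := wronskian_antiderivative I_open I_interval fgC.
  have quad := quadratic_of_polynomial I_open fgC FGC poly.
  have [al [be [E1 E2]]] :=
    quadratic_trigonometric I_nonempty I_open I_interval fgC FGC quad dphi.
  exists phi, al, be; split=> //.
  exact: (derive_neq0_monotonic I_interval dphi (wronskian_neq0 fgC)).
- case=> [?|[phi0 [al [be [phim E1 E2]]]]]; [by left|right].
  have [phi dphi] := wronskian_antiderivative I_open I_interval fgC.
  have quad := quadratic_of_trigonometric I_open I_interval fgC FGC phim E1 E2.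
  have [M1 M2] := quadratic_means I_nonempty I_open I_interval fgC FGC quad dphi.
  by exists phi.
- case=> [?|[phi [dphi M1 M2]]]; [by left|right].
  exists phi; split=> //.
    exact: (derive_neq0_monotonic I_interval dphi (wronskian_neq0 fgC)).
  by move=> x; rewrite inE => Ix; exact: is_derive_continuous (dphi x Ix).
- case=> [eqv|[phi [_ _ M1 M2]]]; first by apply: mean_of_alternative; left.
  by move=> x y Ix Iy; rewrite M1// M2.
Qed.
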